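(* There is a function $\varepsilon(n)\to0$ as $n\to\infty$ such that the following holds. Let $A=(a_1,\dots,a_n)$ be an $n$-sided die such that (i) $\max_{j\in[n]}|g_A(j)|\le 2\sqrt{n\log n}$, and (ii) $|\hat f(\alpha,\beta)|^n\le n^{-10}$ for every $(\alpha,\beta)\in[-1/2,1/2]^2$ with $|\alpha|\ge 10^7\log n/n$ or $|\beta|\ge 10^9(\log n/n)^{3/2}$. Then, if $B$ is a uniformly random $n$-sided die, the probability that $A$ beats $B$ is $\frac12+O(\varepsilon(n))$, i.e. lies within $\varepsilon(n)$ of $\frac12$.
   Context: $[n]=\{1,\dots,n\}$. An $n$-sided die is a sequence $(a_1,\dots,a_n)\in[n]^n$ with $\sum_ia_i=n(n+1)/2$; a random die is chosen uniformly among these. $A$ beats $B=(b_1,\dots,b_n)$ if $|\{(i,j):a_i>b_j\}|>|\{(i,j):a_i<b_j\}|$. For $j\in[n]$, $f_A(j)=|\{i:a_i<j\}|+\frac12|\{i:a_i=j\}|$ and $g_A(j)=f_A(j)-j+\frac12$. With $e(x)=\exp(2\pi i x)$, $\hat f(\alpha,\beta)=\frac1n\sum_{j=1}^n e\big(\alpha g_A(j)+\beta(j-(n+1)/2)\big)$ is the characteristic function of the random variable $(U,V)=(g_A(j),j-(n+1)/2)$ with $j$ uniform in $[n]$. $\log$ is the natural logarithm. *)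

(* Defs.v *)
From mathcomp Require Export all_boot all_order all_algebra.
From mathcomp Require Export all_classical all_reals all_analysis.
From mathcomp Require Export complex.

Set Implicit Arguments.
Unset Strict Implicit.
Unset Printing Implicit Defensive.

Import Order.TTheory GRing.Theory Num.Theory.
Import numFieldNormedType.Exports.

Local Open Scope ring_scope.

(* The set [n] = {1, ..., n} is encoded by 'I_n, the ordinal k standing for the
   number pip k = k + 1. *)
Definition pip (n : nat) (k : 'I_n) : nat := k.+1.

Definition dice (n : nat) : {set {ffun 'I_n -> 'I_n}} :=
  [set a : {ffun 'I_n -> 'I_n} |
    (\sum_(i < n) pip (a i) == (n * n.+1) %/ 2)%N].

Definition beats (n : nat) (a b : {ffun 'I_n -> 'I_n}) : bool :=
  (#|[set p : 'I_n * 'I_n | pip (a p.1) < pip (b p.2)]|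
     < #|[set p : 'I_n * 'I_n | pip (b p.2) < pip (a p.1)]|)%N.

Definition fdie (R : realType) (n : nat) (a : {ffun 'I_n -> 'I_n}) (j : 'I_n)
    : R :=
  #|[set i | (pip (a i) < pip j)%N]|%:R
  + 2^-1 * #|[set i | pip (a i) == pip j]|%:R.

Definition gdie (R : realType) (n : nat) (a : {ffun 'I_n -> 'I_n}) (j : 'I_n)
    : R :=
  fdie R a j - (pip j)%:R + 2^-1.

(* e(x) = exp(2 pi i x) *)
Definition e2pi (R : realType) (x : R) : R[i] :=
  Complex (cos (2 * pi * x)) (sin (2 * pi * x)).

Definition fhat (R : realType) (n : nat) (a : {ffun 'I_n -> 'I_n})
    (alpha beta : R) : R[i] :=
  n%:R^-1 * \sum_(j < n)
    e2pi (alpha * gdie R a j + beta * ((pip j)%:R - (n%:R + 1) / 2)).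

Definition prob_beats (R : realType) (n : nat) (a : {ffun 'I_n -> 'I_n}) : R :=
  #|[set b in dice n | beats a b]|%:R / #|dice n|%:R.

(* Main.v *)
(** Let b_1, ..., b_n be independent and uniform in [n], and put
    S = sum_i g_A(b_i), T = sum_i (b_i - (n+1)/2).  A random die is b
    conditioned on T = 0, and on that event A beats b exactly when S < 0;
    moreover E e(alpha S + beta T) = fhat(alpha, beta)^n.  So it suffices to
    compare the events S < 0 and S > 0 inside T = 0, an event of probability at
    least of order n^(-3/2): the characteristic function of T is nonnegative up
    to n^(-10), and at least 1/2 for |beta| <= n^(-3/2)/4.

    No Gaussian approximation is needed.  Where fhat^n is not negligible,
    alpha U + beta V has size n^(-1/2) up to logarithms, and since U and V have
    mean zero the imaginary part of fhat is cubic in it; hence fhat^n is real up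
    to n^(-1/2) polylog(n), which makes the law of (S, T) nearly symmetric.  To
    turn this into a statement on the sign of S, the sign is replaced by its
    convolution with a Fejer kernel, a trigonometric polynomial whose
    frequencies lie in the range |alpha| <= 1/2 covered by the hypothesis (S is
    only half-integral, so exact Fourier inversion would need |alpha| <= 1).
    The replacement costs at most the probability that S is small, and the same
    kernel bounds each P(S = u, T = 0) by n^(-5/2) polylog(n).  All frequencies
    are taken on finite grids, so only finite sums occur.

    In the final estimates everything is compared with powers of
    v = n^(-1/80), which absorbs constants and logarithms. *)
Require Import Defs.
From mathcomp Require Import ring lra zify.
Import Order.TTheory GRing.Theory Num.Theory.
Import numFieldNormedType.Exports.
Set Implicit Arguments.
Unset Strict Implicit.
Unset Printing Implicit Defensive.
Local Open Scope ring_scope.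

(** * Trigonometric estimates *)

Section Trigonometry.
Variable R : realType.
Implicit Types x y t p : R.

Lemma sin_MVT x : 0 <= x -> exists2 c, 0 <= c <= x & sin x = cos c * x.
Proof.
move=> x0.
have dsin y : y \in `]0, x[ -> is_derive y (1 : R) sin (cos y).
  by move=> _; exact: is_derive_sin.
have csin : {within `[0, x], continuous (@sin R)}%classic.
  by apply: continuous_subspaceT => y; exact: continuous_sin.
have [c] := MVT_segment x0 dsin csin.
by rewrite in_itv /= sin0 !subr0 => cx ->; exists c.
Qed.

Lemma normr_sin_le x : `|sin x| <= `|x|.
Proof.
wlog x0 : x / 0 <= x.
  move=> H; have [/H //|/ltW x0] := leP 0 x.
  by rewrite -normrN -sinN -(normrN x) H // oppr_ge0.
have [c _ ->] := sin_MVT x0.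
by rewrite normrM ler_piMl // cos_max.
Qed.

Lemma cos_half x : cos x = 1 - 2 * sin (x / 2) ^+ 2.
Proof.
have {1}-> : x = x / 2 + x / 2 by lra.
rewrite cosD -!expr2; have := cos2Dsin2 (x / 2); lra.
Qed.

Lemma cos_ge x : 1 - x ^+ 2 / 2 <= cos x.
Proof.
rewrite cos_half; have := normr_sin_le (x / 2).
rewrite -(ler_pXn2r (n := 2)) ?nnegrE // !real_normK ?num_real //; lra.
Qed.

(** With [sin x = cos c * x] for some [0 <= c <= x], the error is [(1 - cos c) * x], and [1 - cos c]
    is quadratic. This is the source of the cubic bound on the imaginary part of [fhat]. *)
Lemma normr_sin_sub_le x : `|sin x - x| <= `|x| ^+ 3.
Proof.
wlog x0 : x / 0 <= x.
  move=> H; have [/H //|/ltW x0] := leP 0 x.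
  have := H (- x); rewrite oppr_ge0 sinN normrN -opprD normrN; exact.
have [c /andP[c0 cx] ->] := sin_MVT x0.
have -> : cos c * x - x = - ((1 - cos c) * x) by ring.
rewrite normrN (ger0_norm x0) ger0_norm; last first.
  by rewrite mulr_ge0 // subr_ge0 cos_le1.
rewrite exprSr ler_wpM2r //; apply: (@le_trans _ _ (c ^+ 2 / 2)).
  have := cos_ge c; lra.
by apply: (@le_trans _ _ (c ^+ 2)); [nra|rewrite lerXn2r].
Qed.

(* Halving the angle keeps the quadratic lower bound on cos useful up to 5/2. *)
Lemma sin_ge y : 0 <= y <= 5 / 2 -> y / 21 <= sin y.
Proof.
move=> /andP[y0 y1]; set z := y / 2.
have z0 : 0 <= z by rewrite /z; lra.
have z1 : z <= 5 / 4 by rewrite /z; lra.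
have cz c : 0 <= c -> c <= z -> 7 / 32 <= cos c.
  move=> c0 cz; apply: le_trans (cos_ge c); nra.
have [c /andP[c0 cz'] sz] := sin_MVT z0.
have -> : y = z + z by rewrite /z; lra.
rewrite sinD sz.
have c1 := cz _ c0 cz'; have c2 := cz _ z0 (lexx _).
have h : (7 / 32) * (7 / 32) <= cos c * cos z.
  apply: ler_pM => //; lra.
have h' : 49 / 1024 * z <= cos c * cos z * z by apply: ler_wpM2r => //; lra.
have -> : cos c * z * cos z + cos z * (cos c * z) = 2 * (cos c * cos z * z).
  ring.
lra.
Qed.

(** Telescoping: each [2 sin(t/2) cos(l t + p)] is a difference of consecutive sines. The phase [p]
    also covers sine sums, through [p = - (pi / 2)]. *)
Lemma dirichlet_sum (m : nat) t p :
  2 * sin (t / 2) * \sum_(l < m) cos (l%:R * t + p)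
  = sin (m%:R * t + p - t / 2) - sin (p - t / 2).
Proof.
elim: m => [|m IH]; first by rewrite big_ord0 mulr0 mul0r add0r subrr.
rewrite big_ord_recr /= mulrDr IH.
have -> : m.+1%:R * t + p - t / 2 = (m%:R * t + p) + t / 2.
  by rewrite -natr1; field.
rewrite (sinD _ (t / 2)) (sinB (m%:R * t + p)); ring.
Qed.

Lemma normr_dirichlet_sum (m : nat) t p :
  `|sin (t / 2) * \sum_(l < m) cos (l%:R * t + p)| <= 1.
Proof.
have := dirichlet_sum m t p.
set s := \sum_(l < m) _ => H.
have -> : sin (t / 2) * s = (sin (m%:R * t + p - t / 2) - sin (p - t / 2)) / 2.
  by rewrite -H; field.
have := sin_max (m%:R * t + p - t / 2); have := sin_max (p - t / 2).
rewrite !ler_norml => /andP[? ?] /andP[? ?]; apply/andP; split; lra.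
Qed.

End Trigonometry.

(** * The Fejer kernel and the smoothed sign *)

Section Fejer.
Variable R : realType.
Implicit Types x y t p w u : R.

Lemma sinD_int x z : z \is a Num.int -> sin (x + z * (2 * pi)) = sin x.
Proof.
have two : 2 * pi = pi *+ 2 :> R by rewrite mulr_natl.
have nat_case (n : nat) y : sin (y + n%:R * (2 * pi)) = sin y.
  by rewrite two mulr_natl (periodicn (@sinD2pi R)).
case/intrP => -[n|n] ->; first exact: nat_case.
rewrite NegzE mulrNz -pmulrn mulNr.
by rewrite -[LHS](nat_case n.+1) subrK.
Qed.

Lemma sin_neq0 x : 0 < `|x| < pi -> sin x != 0.
Proof.
move=> /sin_gt0_pi; have [x0|x0] := leP 0 x.
  by rewrite ger0_norm // lt0r => /andP[].
by rewrite ltr0_norm // sinN lt0r oppr_eq0 => /andP[].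
Qed.

Lemma cos_sum_period (m : nat) t p z : z \is a Num.int ->
  m%:R * t = z * (2 * pi) -> sin (t / 2) != 0 ->
  \sum_(l < m) cos (l%:R * t + p) = 0.
Proof.
move=> zint mt st; have := dirichlet_sum m t p.
rewrite mt.
have -> : z * (2 * pi) + p - t / 2 = (p - t / 2) + z * (2 * pi) by ring.
rewrite sinD_int // subrr => /eqP.
by rewrite !mulf_eq0 (negbTE st) pnatr_eq0 /= => /eqP.
Qed.

(** Up to normalisation, the squared modulus of the geometric sum of [exp(i j t)], [j < K], with
    [t = pi w / (2 K)]. At [w = 2 * S] its frequencies in [S] are [(i - j) / (2 K)], which stay
    within [1/2]. *)
Definition fejer (K : nat) (w : R) : R :=
  (\sum_(i < K) \sum_(j < K) cos ((i%:R - j%:R) * (pi * w / (2 * K%:R))))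
  / (4 * K%:R ^+ 2).

Lemma fejerE (K : nat) w (t := pi * w / (2 * K%:R)) : fejer K w =
  ((\sum_(j < K) cos (j%:R * t)) ^+ 2 + (\sum_(j < K) sin (j%:R * t)) ^+ 2)
  / (4 * K%:R ^+ 2).
Proof.
rewrite /fejer -/t !expr2 !big_distrlr /= -big_split /=; congr (_ / _).
apply: eq_bigr => i _; rewrite -big_split; apply: eq_bigr => j _ /=.
by rewrite mulrBl cosB.
Qed.

Lemma fejer_ge0 (K : nat) w : 0 <= fejer K w.
Proof. by rewrite fejerE divr_ge0 ?addr_ge0 ?sqr_ge0 ?mulr_ge0. Qed.

Lemma fejerN (K : nat) w : fejer K (- w) = fejer K w.
Proof.
rewrite /fejer; congr (_ / _).
apply: eq_bigr => i _; apply: eq_bigr => j _.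
by rewrite mulrN mulNr mulrN cosN.
Qed.

Lemma fejer0 (K : nat) : (0 < K)%N -> fejer K 0 = 4^-1.
Proof.
move=> K0; rewrite /fejer mulr0 mul0r.
under eq_bigr do under eq_bigr do rewrite mulr0 cos0.
rewrite !sumr_const card_ord -mulr_natr.
have : K%:R != 0 :> R by rewrite pnatr_eq0 -lt0n.
by move=> K0'; field.
Qed.

(** Each off-diagonal pair makes [i - j], a nonzero number, of full turns and cancels; the [K]
    diagonal pairs contribute [4 K] each, matching the normalisation [4 K^2]. *)
Lemma fejer_sum_period (K : nat) w : (0 < K)%N ->
  \sum_(l < 4 * K) fejer K (w + l%:R) = 1.
Proof.
move=> K0; have K0' : 0 < K%:R :> R by rewrite ltr0n.
rewrite /fejer -mulr_suml exchange_big /=.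
under eq_bigr do rewrite exchange_big /=.
rewrite (eq_bigr (fun=> (4 * K)%:R)) => [|i _]; last first.
  rewrite (bigD1 i) //= [X in _ + X]big1 => [|j ji].
    rewrite addr0 (eq_bigr (fun=> 1)) => [|l _].
      by rewrite sumr_const card_ord.
    by rewrite subrr mul0r cos0.
  set t : R := (i%:R - j%:R) * (pi / (2 * K%:R)).
  rewrite (eq_bigr (fun l : 'I_(4 * K) =>
      cos (l%:R * t + (i%:R - j%:R) * (pi * w / (2 * K%:R))))); last first.
    by move=> l _; congr cos; rewrite /t; field; rewrite gt_eqF.
  apply: (@cos_sum_period _ _ _ (i%:R - j%:R)).
  - by rewrite rpredB // natr_int.
  - by rewrite /t natrM; field; rewrite gt_eqF.
  apply: sin_neq0; rewrite /t !normrM; set d := `|_ - _|.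
  have d0 : 0 < d.
    by rewrite normr_gt0 subr_eq0 eqr_nat eq_sym.
  have dK : d < K%:R.
    rewrite /d ltr_norml; have := ltn_ord i; have := ltn_ord j.
    rewrite -!(ltr_nat R); have := ler0n R i; have := ler0n R j.
    by move=> ? ? ? ?; apply/andP; split; lra.
  have pi0 := pi_gt0 R.
  rewrite !ger0_norm ?mulr_ge0 ?invr_ge0 ?mulr_ge0 ?ler0n ?ltW //.
  have -> : d * (pi / (2 * K%:R)) * 2^-1 = (d / K%:R) * (pi / 4).
    by field; rewrite gt_eqF.
  have q0 : 0 < d / K%:R by rewrite divr_gt0.
  have q1 : d / K%:R < 1 by rewrite ltr_pdivrMr // mul1r.
  by apply/andP; split; nra.
rewrite sumr_const card_ord -mulr_natr natrM.
by field; rewrite gt_eqF.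
Qed.

(** As [sin (t / 2) >= w / (42 K)], the Dirichlet bound makes the cosine and the sine sum at most
    [42 K / w], whence [882 = 2 * 42^2 / 4]. *)
Lemma fejer_le (K : nat) w : (0 < K)%N -> 0 < w <= 5 / 2 * K%:R ->
  fejer K w <= 882 / w ^+ 2.
Proof.
move=> K0 /andP[w0 wK]; have K0' : 0 < K%:R :> R by rewrite ltr0n.
rewrite fejerE; set t := pi * w / (2 * K%:R).
have pi2 := pi_ge2 R; have pi4 : pi < 4 :> R by have := pihalf_lt2 R; lra.
have t0 : w / K%:R <= t.
  rewrite /t -mulrA invfM mulrA mulrACA; rewrite ler_peMl //; last lra.
  by rewrite divr_ge0 // ltW.
have q0 : 0 < w / K%:R by rewrite divr_gt0.
have q1 : w / K%:R <= 5 / 2 by rewrite ler_pdivrMr.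
have tE : t = pi / 2 * (w / K%:R) by rewrite /t; field; rewrite gt_eqF.
have st : w / K%:R / 42 <= sin (t / 2).
  apply: (@le_trans _ _ (t / 2 / 21)); first lra.
  by apply: sin_ge; apply/andP; split; [lra | nra].
have sq_le p : (\sum_(j < K) cos (j%:R * t + p)) ^+ 2 <= (42 * K%:R / w) ^+ 2.
  have := normr_dirichlet_sum K t p; set s := \sum_(j < K) _ => H.
  rewrite -(real_normK (num_real s)) lerXn2r ?nnegrE //.
    by rewrite divr_ge0 ?mulr_ge0 // ltW.
  have s0 : 0 < sin (t / 2) by lra.
  move: H; rewrite normrM (gtr0_norm s0) => H.
  rewrite ler_pdivlMr //.
  have : w / K%:R / 42 * `|s| <= 1 by apply: le_trans H; rewrite ler_wpM2r.
  move=> /(ler_wpM2r (ltW K0')).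
  have -> : w / K%:R / 42 * `|s| * K%:R = `|s| * w / 42.
    by field; rewrite gt_eqF.
  lra.
have -> : 882 / w ^+ 2 = ((42 * K%:R / w) ^+ 2 + (42 * K%:R / w) ^+ 2)
   / (4 * K%:R ^+ 2).
  by field; rewrite !gt_eqF.
rewrite ler_pM2r ?invr_gt0 ?mulr_gt0 ?exprn_gt0 //.
apply: lerD.
  by have := sq_le 0; under eq_bigr do rewrite addr0.
by have := sq_le (- (pi / 2)); under eq_bigr do rewrite cosBpihalf.
Qed.

(* The sign function convolved with the Fejer kernel: a trigonometric
   polynomial of degree less than [K] and period [4 * K]. *)
Definition smooth_sign (K : nat) (u : R) : R :=
  \sum_(v < 2 * K) (fejer K (u - v%:R - 2^-1) - fejer K (u + v%:R + 2^-1)).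

Lemma smooth_signN (K : nat) u : smooth_sign K (- u) = - smooth_sign K u.
Proof.
rewrite /smooth_sign -sumrN; apply: eq_bigr => v _.
rewrite opprB -fejerN -(fejerN K (- u + _ + _)).
by congr (fejer _ _ - fejer _ _); ring.
Qed.

(** The two families of translates together fill one period, of total mass 1; replacing the first
    family by 1 minus the second leaves twice the second. *)
Lemma smooth_signE (K : nat) u : (0 < K)%N ->
  1 - smooth_sign K u = 2 * \sum_(v < 2 * K) fejer K (u + v%:R + 2^-1).
Proof.
move=> K0; have := fejer_sum_period (u - (2 * K)%:R + 2^-1) K0.
have -> : (4 * K = 2 * K + 2 * K)%N by lia.
rewrite big_split_ord /= (reindex_inj rev_ord_inj) /=.
rewrite (eq_bigr (fun v : 'I_(2 * K) => fejer K (u - v%:R - 2^-1))); last first.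
  move=> v _; congr fejer; rewrite natrB; last exact: ltn_ord.
  rewrite -[v.+1%:R]natr1; lra.
rewrite [X in _ + X = _](eq_bigr (fun v : 'I_(2 * K) =>
    fejer K (u + v%:R + 2^-1))); last first.
  by move=> v _; congr fejer; rewrite natrD; lra.
rewrite /smooth_sign sumrB; lra.
Qed.

Lemma smooth_sign_le1 (K : nat) u : (0 < K)%N -> `|smooth_sign K u| <= 1.
Proof.
move=> K0.
have le1 y : smooth_sign K y <= 1.
  rewrite -subr_ge0 smooth_signE // mulr_ge0 // sumr_ge0 // => v _.
  exact: fejer_ge0.
by rewrite ler_norml le1 andbT lerNl -smooth_signN le1.
Qed.

(** The quadratic decay of the kernel makes the missing mass a tail of order [1 / u]. The bound
    [u <= K / 2] keeps all [2 * K] translates in the range of [fejer_le]. *)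
Lemma smooth_sign_near (K : nat) u : (0 < K)%N -> 0 < u <= K%:R / 2 ->
  `|smooth_sign K u - 1| <= 1764 / u.
Proof.
move=> K0 /andP[u0 uK].
rewrite distrC ger0_norm; last first.
  rewrite subr_ge0; have := smooth_sign_le1 u K0.
  by rewrite ler_norml => /andP[].
rewrite smooth_signE //.
(* Since [(x + 1/2)^2 >= x (x + 1)], the term at [x = u + v] is at most 882 times a difference of
   consecutive reciprocals, and the sum telescopes. *)
apply: (@le_trans _ _
    (2 * (882 * \sum_(0 <= v < 2 * K) ((u + v%:R)^-1 - (u + v.+1%:R)^-1)))).
  rewrite ler_pM2l // mulr_sumr big_mkord; apply: ler_sum => v _.
  have v0 : 0 <= v%:R :> R by [].
  have vK : v%:R <= 2 * K%:R - 1 :> R.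
    by rewrite lerBrDr natr1 -natrM ler_nat.
  apply: (le_trans (fejer_le K0 _)); first by apply/andP; split; lra.
  apply: ler_wpM2l; first exact: ler0n.
  rewrite -[v.+1%:R]natr1.
  have -> : (u + v%:R)^-1 - (u + (v%:R + 1))^-1
            = ((u + v%:R) * (u + (v%:R + 1)))^-1.
    field; rewrite !gt_eqF //=; lra.
  rewrite lef_pV2 ?posrE; first nra; first by apply: exprn_gt0; lra.
  by apply: mulr_gt0; lra.
rewrite (@telescope_sumr_eq _ 0 (2 * K) (fun v => - (u + v%:R)^-1)) //;
  last first.
  by move=> v _; rewrite opprK addrC.
rewrite addr0 opprK; have : 0 <= (u + (2 * K)%:R)^-1.
  by rewrite invr_ge0 addr_ge0 // ltW.
lra.
Qed.

(** Up to scaling, the sine coefficient at frequency [d] of the square wave of period [4 * K]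
    sampled at half-integers. *)
Definition sign_coef (K : nat) (d : R) : R :=
  \sum_(v < 2 * K) sin (d * ((v%:R + 2^-1) * pi / (2 * K%:R))).

Lemma smooth_sign_expand (K : nat) u : smooth_sign K u =
  (\sum_(i < K) \sum_(j < K) 2 * sign_coef K (i%:R - j%:R)
     * sin ((i%:R - j%:R) * (pi * u / (2 * K%:R)))) / (4 * K%:R ^+ 2).
Proof.
rewrite /smooth_sign /fejer.
under eq_bigr do rewrite -mulrBl -sumrB.
rewrite -mulr_suml exchange_big /=; congr (_ / _).
apply: eq_bigr => i _.
under eq_bigr do rewrite -sumrB.
rewrite exchange_big /=; apply: eq_bigr => j _.
rewrite /sign_coef -mulrA mulr_suml mulr_sumr.
apply: eq_bigr => v _.
set A := (_ - _) * (pi * u / _); set B := (_ - _) * (_ * pi / _).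
have -> : (i%:R - j%:R) * (pi * (u - v%:R - 2^-1) / (2 * K%:R)) = A - B.
  by rewrite /A /B; ring.
have -> : (i%:R - j%:R) * (pi * (u + v%:R + 2^-1) / (2 * K%:R)) = A + B.
  by rewrite /A /B; ring.
rewrite cosB cosD; ring.
Qed.

Lemma sign_coef0 (K : nat) : sign_coef K 0 = 0.
Proof. by rewrite /sign_coef big1 // => v _; rewrite mul0r sin0. Qed.

Lemma sign_coefN (K : nat) d : sign_coef K (- d) = - sign_coef K d.
Proof.
by rewrite /sign_coef -sumrN; apply: eq_bigr => v _; rewrite mulNr sinN.
Qed.

(** The Dirichlet bound with step [d * pi / (2 K)] gives the [1 / d] decay of a square wave, so that
    summing over frequencies costs only a logarithm. *)
Lemma sign_coef_le (K : nat) d : 0 < `|d| <= K%:R ->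
  `|sign_coef K d| <= 42 * K%:R / `|d|.
Proof.
wlog d0 : d / 0 <= d.
  move=> H; have [/H //|/ltW d0] := leP 0 d.
  by have := H (- d); rewrite sign_coefN !normrN oppr_ge0; apply.
rewrite (ger0_norm d0) => /andP[{}d0 dK].
have K0 : 0 < K%:R :> R by lra.
set t := d * (pi / (2 * K%:R)).
have := normr_dirichlet_sum (2 * K) t (t / 2 - pi / 2).
rewrite (eq_bigr (fun v : 'I_(2 * K) =>
   sin (d * ((v%:R + 2^-1) * pi / (2 * K%:R))))) => [|v _]; last first.
  rewrite addrA cosBpihalf; congr sin; rewrite /t; field.
  by rewrite gt_eqF.
rewrite -/(sign_coef K d) normrM.
have pi2 := pi_ge2 R; have pi4 : pi < 4 :> R by have := pihalf_lt2 R; lra.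
have tE : t / 2 = d / K%:R * (pi / 4) by rewrite /t; field; rewrite gt_eqF.
have q0 : 0 < d / K%:R by rewrite divr_gt0.
have q1 : d / K%:R <= 1 by rewrite ler_pdivrMr // mul1r.
have st : d / K%:R / 42 <= sin (t / 2).
  apply: (@le_trans _ _ (t / 2 / 21)); first nra.
  by apply: sin_ge; apply/andP; split; nra.
have s0 : 0 < sin (t / 2) by lra.
rewrite (gtr0_norm s0) ler_pdivlMr // => H.
have : d / K%:R / 42 * `|sign_coef K d| <= 1.
  by apply: le_trans H; rewrite ler_wpM2r.
move=> /(ler_wpM2r (ltW K0)).
have -> : d / K%:R / 42 * `|sign_coef K d| * K%:R = `|sign_coef K d| * d / 42.
  by field; rewrite gt_eqF.
lra.
Qed.

End Fejer.

(** * Dice and scores *)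

Section ComplexFacts.
Variable R : realType.
Implicit Types (z : R[i]) (x y : R).
Local Notation normc := ComplexField.Normc.normc.

Lemma e2piD x y : e2pi (x + y) = e2pi x * e2pi y.
Proof.
rewrite /e2pi mulrDr cosD sinD; apply/eqP; rewrite eq_complex /= eqxx /=.
by apply/eqP; ring.
Qed.

Lemma e2pi_sum (I : finType) (F : I -> R) :
  e2pi (\sum_i F i) = \prod_i e2pi (F i).
Proof.
apply: (big_morph (@e2pi R) e2piD).
by rewrite /e2pi mulr0 cos0 sin0.
Qed.

Lemma normc_e2pi x : normc (e2pi x) = 1.
Proof. by rewrite /e2pi /= cos2Dsin2 sqrtr1. Qed.

Lemma normr_Re_le z : `|complex.Re z| <= normc z.
Proof.
by case: z => a b /=; rewrite -sqrtr_sqr ler_wsqrtr // lerDl sqr_ge0.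
Qed.

Lemma normcX z n : normc (z ^+ n) = normc z ^+ n.
Proof.
elim: n => [|n IH]; first by rewrite !expr0 ComplexField.Normc.normc1.
by rewrite !exprS ComplexField.Normc.normcM IH.
Qed.

Lemma Re_sum (I : finType) (F : I -> R[i]) :
  complex.Re (\sum_i F i) = \sum_i complex.Re (F i).
Proof. by apply: (big_morph (@complex.Re R)) => // -[a b] [c d]. Qed.

Lemma Im_sum (I : finType) (F : I -> R[i]) :
  complex.Im (\sum_i F i) = \sum_i complex.Im (F i).
Proof. by apply: (big_morph (@complex.Im R)) => // -[a b] [c d]. Qed.

Lemma normc_sum_le (I : finType) (F : I -> R[i]) :
  normc (\sum_i F i) <= \sum_i normc (F i).
Proof.
elim/big_ind2: _ => // [|x1 x2 y1 y2 h1 h2].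
  by rewrite ComplexField.Normc.normc0.
exact: le_trans (le_normcD _ _) (lerD h1 h2).
Qed.

(** In the unit disc real parts are at most 1, so each further factor [z] adds at most [|Im z|] to
    the imaginary part. *)
Lemma normr_ImX_le z n : normc z <= 1 ->
  `|complex.Im (z ^+ n)| <= n%:R * `|complex.Im z|.
Proof.
move=> z1; elim: n => [|n IH]; first by rewrite expr0 mul0r normr0.
have re1 (w : R[i]) : normc w <= 1 -> `|complex.Re w| <= 1.
  by apply: le_trans; exact: normr_Re_le.
have zn1 : normc (z ^+ n) <= 1.
  by rewrite normcX exprn_ile1 //; case: (z) => a b; rewrite sqrtr_ge0.
have := re1 _ z1; have := re1 _ zn1; move: IH.
rewrite exprS; case: (z) (z ^+ n) => [a b] [c d] /= IH c1 a1.
apply: (le_trans (ler_normD _ _)); rewrite !normrM -natr1 mulrDl mul1r.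
apply: lerD; first by apply: le_trans IH; rewrite ler_piMl.
by rewrite ler_piMr.
Qed.

End ComplexFacts.

(** * Score and excess of a sequence against a fixed die *)

Section Die.
Variables (R : realType) (n : nat) (A : {ffun 'I_n -> 'I_n}).
Implicit Type b : {ffun 'I_n -> 'I_n}.
Local Notation normc := ComplexField.Normc.normc.
Local Notation g := (gdie R A).

Definition centred (j : 'I_n) : R := (pip j)%:R - (n%:R + 1) / 2.
Definition score b : R := \sum_i g (b i).
Definition excess b : R := \sum_i centred (b i).

Lemma half_square : ((n * n.+1) %/ 2)%:R = n%:R * (n%:R + 1) / 2 :> R.
Proof.
have h : ((n * n.+1) %/ 2 * 2 = n * n.+1)%N.
  by rewrite divnK // dvdn2 oddM oddS andbN.
have : ((n * n.+1) %/ 2 * 2)%:R = (n * n.+1)%:R :> R by rewrite h.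
rewrite !natrM -[n.+1%:R]natr1; lra.
Qed.

Lemma excessE b :
  excess b = (\sum_i pip (b i))%:R - ((n * n.+1) %/ 2)%:R.
Proof.
rewrite /excess sumrB natr_sum sumr_const card_ord half_square.
by rewrite -[(_ / 2) *+ n]mulr_natl mulrA.
Qed.

Lemma dice_excess b : (b \in dice n) = (excess b == 0).
Proof. by rewrite inE excessE subr_eq0 eqr_nat. Qed.

Lemma excess_int b : excess b \is a Num.int.
Proof. by rewrite excessE rpredB // natr_int. Qed.

Lemma normr_centred_le j : `|centred j| <= n%:R / 2.
Proof.
rewrite /centred /pip ler_norml; have := ltn_ord j; rewrite -(ler_nat R).
have := ler0n R j; rewrite -natr1 => ? ?; apply/andP; split; lra.
Qed.

Lemma normr_excess_le b : `|excess b| <= n%:R ^+ 2 / 2.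
Proof.
apply: (le_trans (ler_norm_sum _ _ _)).
apply: (@le_trans _ _ (\sum_(i < n) n%:R / 2)).
  by apply: ler_sum => i _; exact: normr_centred_le.
by rewrite sumr_const card_ord -[(_ / 2) *+ n]mulr_natl expr2 mulrA.
Qed.

Lemma sum_centred : \sum_j centred j = 0.
Proof.
rewrite /centred sumrB sumr_const card_ord -natr_sum.
have -> : (\sum_(i < n) pip i = (n * n.+1) %/ 2)%N.
  rewrite /pip -(big_mkord xpredT (fun i => i.+1)).
  rewrite divn2 mulnC -[(n.+1 * n)./2](bin2 n.+1) -bin2_sum.
  by rewrite big_nat_recl.
by rewrite half_square -[(_ / 2) *+ n]mulr_natl mulrA subrr.
Qed.

Lemma score_half_int b : 2 * score b \is a Num.int.
Proof.
rewrite /score mulr_sumr rpred_sum // => i _.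
rewrite /gdie /fdie.
set a := #|_|%:R; set c := #|_|%:R; set d := (pip _)%:R.
have -> : 2 * (a + 2^-1 * c - d + 2^-1) = 2 * a + c - 2 * d + 1 by field.
by rewrite rpredD ?rpredB ?rpredD ?rpredM ?natr_int // rpred1.
Qed.

Lemma normr_score_le b B : (forall j, `|g j| <= B) ->
  `|score b| <= n%:R * B.
Proof.
move=> gB; apply: (le_trans (ler_norm_sum _ _ _)).
apply: (@le_trans _ _ (\sum_(i < n) B)); first by apply: ler_sum.
by rewrite sumr_const card_ord mulr_natl.
Qed.

Lemma card_pairs_fst (r : 'I_n -> 'I_n -> bool) :
  #|[set p : 'I_n * 'I_n | r p.1 p.2]| = (\sum_i #|[set j | r i j]|)%N.
Proof.
rewrite -sum1_card (eq_bigl (fun p : 'I_n * 'I_n => xpredT p.1 && r p.1 p.2));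
  last by move=> p; rewrite inE.
rewrite -(pair_big_dep xpredT (fun i j => r i j) (fun _ _ => 1%N)) /=.
apply: eq_bigr => i _; rewrite -sum1_card.
by apply: eq_bigl => j; rewrite inE.
Qed.

Lemma card_pairs (r : 'I_n -> 'I_n -> bool) :
  #|[set p : 'I_n * 'I_n | r p.1 p.2]| = (\sum_j #|[set i | r i j]|)%N.
Proof.
rewrite card_pairs_fst.
under eq_bigr do rewrite -sum1dep_card.
rewrite (exchange_big_dep xpredT) //=; apply: eq_bigr => j _.
by rewrite sum1dep_card.
Qed.

Lemma card_split (j : 'I_n) :
  (#|[set i | pip (A i) < pip j]| + #|[set i | pip (A i) == pip j]|
    + #|[set i | pip j < pip (A i)]| = n)%N.
Proof.
rewrite -!sum1_card -[RHS]card_ord -sum1_card.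
rewrite [RHS](bigID (fun i => pip (A i) < pip j)%N) /= -addnA.
congr (_ + _)%N; first by apply: eq_bigl => i; rewrite inE.
rewrite [RHS](bigID (fun i => pip (A i) == pip j)%N) /=.
by congr (_ + _)%N; apply: eq_bigl => i; rewrite !inE; case: ltngtP.
Qed.

(** Eliminating the ties by [card_split] leaves the comparison of [A] with the face [j], corrected
    by a multiple of [centred j]. Summed over the faces of [b], the first part decides [beats] and
    the second is the excess. *)
Lemma gdieE (j : 'I_n) :
  2 * g j = #|[set i | (pip (A i) < pip j)%N]|%:R
            - #|[set i | (pip j < pip (A i))%N]|%:R + - 2 * centred j.
Proof.
rewrite /gdie /fdie /centred.
have /(congr1 (fun k => k%:R : R)) := card_split j.
rewrite !natrD => h; lra.
Qed.

Lemma beats_score b : b \in dice n -> beats A b = (score b < 0).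
Proof.
rewrite dice_excess => /eqP T0; rewrite /beats.
rewrite (card_pairs (fun i j => pip (A i) < pip (b j))%N).
rewrite (card_pairs (fun i j => pip (b j) < pip (A i))%N).
rewrite -(ltr_nat R) !natr_sum -subr_lt0 -sumrB.
rewrite -[RHS](pmulr_rlt0 _ (ltr0Sn R 1)) /score mulr_sumr.
under [in RHS]eq_bigr do rewrite gdieE.
by rewrite [in RHS]big_split /= -mulr_sumr -/(excess b) T0 mulr0 addr0.
Qed.

Lemma card_ord_lt (i : 'I_n) : #|[set j : 'I_n | (j < i)%N]| = i.
Proof.
rewrite -sum1_card (eq_bigl (fun j : 'I_n => (j < i)%N)); last first.
  by move=> j; rewrite inE.
by rewrite (big_ord_narrow (ltnW (ltn_ord i))) sum1_card card_ord.
Qed.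

Lemma card_ord_gt (i : 'I_n) : (#|[set j : 'I_n | (i < j)%N]| + i.+1)%N = n.
Proof.
have := cardsC [set j : 'I_n | (i < j)%N]; rewrite card_ord.
apply: etrans; congr (_ + _)%N.
transitivity #|[set j : 'I_n | (j < i)%N] :|: [set i]|.
  rewrite -[LHS](addn1 i) -{1}(card_ord_lt i) -(cards1 i) cardsU.
  rewrite (_ : _ :&: _ = finset.set0) ?cards0 ?subn0 //.
  apply/finset.setP => j; rewrite !inE.
  by case: eqP => [->|]; rewrite ?ltnn ?andbF.
by apply: eq_card => j; rewrite !inE -val_eqE /=; case: ltngtP.
Qed.

(** Double counting: grouped by the faces of [A], the comparisons with all [j] contribute
    [- 2 * centred (A i)] for each [i], and these add up to a multiple of the excess of [A]. *)
Lemma sum_gdie : A \in dice n -> \sum_j g j = 0.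
Proof.
rewrite dice_excess => /eqP A0.
apply: (@mulfI _ 2); first by rewrite pnatr_eq0.
rewrite mulr0 mulr_sumr; under eq_bigr do rewrite gdieE.
rewrite big_split /= -mulr_sumr sum_centred mulr0 addr0 sumrB -!natr_sum.
rewrite -(card_pairs (fun i j => pip (A i) < pip j)%N).
rewrite -(card_pairs (fun i j => pip j < pip (A i))%N).
rewrite (card_pairs_fst (fun i j => pip (A i) < pip j)%N).
rewrite (card_pairs_fst (fun i j => pip j < pip (A i))%N).
rewrite !natr_sum -sumrB.
rewrite (eq_bigr (fun i => - (2 * centred (A i)))); last first.
  move=> i _; rewrite [X in _ - X%:R](card_ord_lt (A i)).
  have /(congr1 (fun k => k%:R : R)) := card_ord_gt (A i).
  by rewrite /centred /pip natrD -natr1; lra.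
by rewrite sumrN -mulr_sumr -/(excess A) A0 mulr0 oppr0.
Qed.

Lemma sum_e2pi (al be : R) :
  \sum_b e2pi (al * score b + be * excess b)
  = (n%:R * fhat A al be) ^+ n.
Proof.
have -> : n%:R * fhat A al be
          = \sum_(j < n) e2pi (al * g j + be * centred j).
  rewrite /fhat mulrA divff ?mul1r //.
Abort.

End Die.

(** * Characteristic functions *)

Section Sums.
Variable R : realType.

(** From a fixed [i], each distance is attained at most once on either side. *)
Lemma sum_dist_le (F : R -> R) (m i : nat) : (forall d : nat, 0 <= F d%:R) ->
  (i < m)%N ->
  \sum_(j < m) F `|i%:R - j%:R| <= 2 * \sum_(d < m) F d%:R.
Proof.
move=> F0 im; rewrite -(big_mkord xpredT (fun j => F `|i%:R - j%:R|)).
rewrite -(big_mkord xpredT (fun j => F j%:R)).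
rewrite (big_cat_nat (n := i)) //=; last exact: ltnW.
have -> : 2 * \sum_(0 <= j < m) F j%:R
  = \sum_(0 <= j < m) F j%:R + \sum_(0 <= j < m) F j%:R by lra.
apply: lerD.
  rewrite big_nat_rev /= add0n.
  rewrite (eq_big_nat _ _ (F2 := fun j => F j.+1%:R)) => [|j /andP[_ ji]].
    apply: (@le_trans _ _ (\sum_(0 <= j < i.+1) F j%:R)).
      by rewrite big_nat_recl // lerDr.
    by rewrite [leRHS](big_cat_nat (n := i.+1)) //= lerDl sumr_ge0.
  by rewrite natrB // ger0_norm ?subKr // subrr.
rewrite -{1}(add0n i) big_addn.
rewrite (eq_big_nat _ _ (F2 := fun j => F j%:R)) => [|j _].
  rewrite [leRHS](big_cat_nat (n := m - i)) //= ?leq_subr //.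
  by rewrite lerDl sumr_ge0.
by rewrite distrC natrD addrK normr_nat.
Qed.

Lemma count_lt_le (m : nat) (X : R) : 0 <= X ->
  \sum_(d < m) ((d%:R < X)%R%:R : R) <= X + 1.
Proof.
move=> X0; elim: m => [|m IH]; first by rewrite big_ord0; lra.
rewrite big_ord_recr /=; case: ltP => mX; last by rewrite addr0.
apply: (@le_trans _ _ (m%:R + 1)); last by rewrite lerD2r ltW.
rewrite lerD2r; apply: (@le_trans _ _ (\sum_(d < m) 1)).
  by apply: ler_sum => d _; rewrite lern1 leq_b1.
by rewrite sumr_const card_ord.
Qed.

(** Induction with [ln (1 - x) <= - x] at [x = 1 / (m + 2)]. The term [d = 0] contributes
    [0^-1 = 0]. *)
Lemma harmonic_le (m : nat) : \sum_(d < m.+2) (d%:R : R)^-1 <= 1 + ln m.+1%:R.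
Proof.
elim: m => [|m IH].
  by rewrite big_ord_recr big_ord1 /= invr0 invr1 add0r ln1 addr0.
rewrite big_ord_recr /=.
apply: (le_trans (lerD IH (lexx _))); rewrite -addrA lerD2l.
have -> : m.+1%:R = m.+2%:R * (1 + - m.+2%:R^-1) :> R.
  by rewrite mulrDr mulr1 mulrN divff ?pnatr_eq0 // -[m.+2%:R]natr1 addrK.
have h : - m.+2%:R^-1 > - 1 :> R by rewrite ltrN2 invf_lt1 ?ltr1n ?ltr0n.
rewrite lnM ?posrE ?ltr0n //; last by rewrite -ltrBlDl sub0r.
by rewrite -addrA gerDl -lerBrDr sub0r; exact: le_ln1Dx h.
Qed.

End Sums.

(** * Joint characteristic function of score and excess *)

Section Characteristic.
Variables (R : realType) (n : nat) (A : {ffun 'I_n -> 'I_n}).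
Hypothesis n0 : (0 < n)%N.
Implicit Types (b : {ffun 'I_n -> 'I_n}) (al be ps x y : R).
Local Notation normc := ComplexField.Normc.normc.
Local Notation g := (gdie R A).
Local Notation S := (score R A).
Local Notation T := (excess R).
Local Notation c := (centred R).

Lemma natr_fhat al be :
  n%:R * fhat A al be = \sum_(j < n) e2pi (al * g j + be * c j).
Proof. by rewrite /fhat mulrA divff ?mul1r // pnatr_eq0 -lt0n. Qed.

Lemma sum_e2pi al be :
  \sum_b e2pi (al * S b + be * T b) = (n%:R * fhat A al be) ^+ n.
Proof.
rewrite natr_fhat.
have -> : (\sum_(j < n) e2pi (al * g j + be * c j)) ^+ n
   = \prod_(i < n) \sum_(j < n) e2pi (al * g j + be * c j).
  by rewrite prodr_const card_ord.
rewrite bigA_distr_bigA /=; apply: eq_bigr => b _.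
rewrite -e2pi_sum; congr e2pi.
by rewrite /score /excess !mulr_sumr -big_split.
Qed.

Lemma normc_nat m : normc (m%:R : R[i]) = m%:R.
Proof.
elim: m => [|m IH]; first by rewrite ComplexField.Normc.normc0.
by rewrite (normcMn (1 : Rcomplex R)) ComplexField.Normc.normc1.
Qed.

Lemma normc_fhat_le1 al be : normc (fhat A al be) <= 1.
Proof.
have n0' : 0 < n%:R :> R by rewrite ltr0n.
rewrite -(ler_pM2l n0') mulr1 -{1}normc_nat -ComplexField.Normc.normcM.
rewrite natr_fhat; apply: le_trans (normc_sum_le _) _.
by under eq_bigr do rewrite normc_e2pi; rewrite sumr_const card_ord.
Qed.

(** The phase only multiplies by a number of modulus 1; it lets the same bound serve sines and
    translated kernels. *)
Lemma sum_cos_le al be ps :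
  `|\sum_b cos (2 * pi * (al * S b + be * T b + ps))|
  <= n%:R ^+ n * normc (fhat A al be) ^+ n.
Proof.
have -> : \sum_b cos (2 * pi * (al * S b + be * T b + ps))
   = complex.Re (e2pi ps * (n%:R * fhat A al be) ^+ n).
  rewrite -sum_e2pi mulr_sumr Re_sum; apply: eq_bigr => b _.
  by rewrite -e2piD addrC.
apply: le_trans (normr_Re_le _) _.
by rewrite ComplexField.Normc.normcM normc_e2pi mul1r normcX
  ComplexField.Normc.normcM normc_nat exprMn.
Qed.

Lemma Im_natM m (z : R[i]) : complex.Im (m%:R * z) = m%:R * complex.Im z.
Proof.
rewrite !mulr_natl; elim: m => [|m IH]; first by rewrite !mulr0n.
by rewrite !mulrS -IH; case: z (z *+ m) {IH} => [u v] [u' v'].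
Qed.

Lemma Im_natXM m (z : R[i]) :
  complex.Im (n%:R ^+ m * z) = n%:R ^+ m * complex.Im z.
Proof. by rewrite -!natrX Im_natM. Qed.

Lemma sum_sin_le al be :
  `|\sum_b sin (2 * pi * (al * S b + be * T b))|
  <= n%:R ^+ n * (n%:R * `|complex.Im (fhat A al be)|).
Proof.
have -> : \sum_b sin (2 * pi * (al * S b + be * T b))
   = complex.Im ((n%:R * fhat A al be) ^+ n).
  by rewrite -sum_e2pi Im_sum.
rewrite exprMn Im_natXM normrM ger0_norm ?exprn_ge0 //.
by rewrite ler_wpM2l ?exprn_ge0 // normr_ImX_le // normc_fhat_le1.
Qed.

Lemma normr_Im_fhat_le al be D : A \in dice n ->
  (forall j, `|2 * pi * (al * g j + be * c j)| <= D) ->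
  `|complex.Im (fhat A al be)| <= D ^+ 3.
Proof.
move=> Ad hD; have n0' : 0 < n%:R :> R by rewrite ltr0n.
rewrite -(ler_pM2l n0') -{1}(ger0_norm (ltW n0')) -normrM -Im_natM natr_fhat.
rewrite Im_sum /=.
(* Subtracting the linear term changes nothing, as [g] and [c] both sum to zero; only the cubic
   remainder of the sine is left. *)
have -> : \sum_(j < n) sin (2 * pi * (al * g j + be * c j))
  = \sum_(j < n) (sin (2 * pi * (al * g j + be * c j))
                  - 2 * pi * (al * g j + be * c j)).
  rewrite sumrB -mulr_sumr big_split /= -!mulr_sumr sum_gdie // sum_centred.
  by rewrite !mulr0 addr0 mulr0 subr0.
apply: le_trans (ler_norm_sum _ _ _) _.
apply: (@le_trans _ _ (\sum_(j < n) D ^+ 3)).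
  apply: ler_sum => j _; apply: le_trans (normr_sin_sub_le _) _.
  by rewrite lerXn2r ?nnegrE // (le_trans _ (hD j)).
by rewrite sumr_const card_ord mulr_natl.
Qed.

(* [beta_grid l] runs over the multiples of 1/(2n^2+1) in [-1/2, 1/2]. *)
Definition beta_grid (l : nat) : R := (l%:R - (n ^ 2)%:R) / (2 * n ^ 2).+1%:R.
Local Notation M := (2 * n ^ 2).+1.

(** Orthogonality on the grid detects [T b = 0]: the excess is an integer of size at most [n^2 / 2],
    so when nonzero it is not a multiple of [2 n^2 + 1]. *)
Lemma grid_sum x ps b :
  \sum_(l < M) cos (2 * pi * (x + beta_grid l * T b + ps))
  = if b \in dice n then M%:R * cos (2 * pi * (x + ps)) else 0.
Proof.
have M0 : 0 < M%:R :> R by rewrite ltr0n.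
rewrite (dice_excess R); case: eqP => [->|/eqP T0].
  under eq_bigr do rewrite mulr0 addr0.
  by rewrite sumr_const card_ord [RHS]mulr_natl.
set t := 2 * pi * (T b / M%:R).
rewrite (eq_bigr (fun l : 'I_M => cos (l%:R * t
   + 2 * pi * (x - (n ^ 2)%:R * T b / M%:R + ps)))); last first.
  by move=> l _; congr cos; rewrite /t /beta_grid; ring.
apply: (@cos_sum_period _ _ _ _ (T b)); first exact: excess_int.
  by rewrite /t; field; rewrite gt_eqF.
apply: sin_neq0.
have -> : t / 2 = pi * (T b / M%:R) by rewrite /t; field; rewrite gt_eqF.
have pi0 := pi_gt0 R.
rewrite normrM (gtr0_norm pi0) mulr_gt0 //=; last first.
  by rewrite normr_gt0 mulf_neq0 // invr_eq0 gt_eqF.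
rewrite gtr_pMr // normrM normfV (gtr0_norm M0) ltr_pdivrMr // mul1r.
apply: le_lt_trans (normr_excess_le R b) _.
rewrite -[M%:R]natr1 natrM natrX.
have : 0 <= n%:R ^+ 2 :> R by rewrite exprn_ge0.
lra.
Qed.

Lemma dice_cos_sum al ps :
  \sum_(b in dice n) cos (2 * pi * (al * S b + ps))
  = M%:R^-1 * \sum_(l < M)
      \sum_b cos (2 * pi * (al * S b + beta_grid l * T b + ps)).
Proof.
have M0 : M%:R != 0 :> R by rewrite pnatr_eq0.
apply: (mulfI M0); rewrite mulVKf // exchange_big /= mulr_sumr big_mkcond /=.
by apply: eq_bigr => b _; rewrite grid_sum.
Qed.

Lemma dice_cos_le al ps (B : nat -> R) :
  (forall l, (l < M)%N ->
     `|\sum_b cos (2 * pi * (al * S b + beta_grid l * T b + ps))|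
       <= n%:R ^+ n * B l) ->
  `|\sum_(b in dice n) cos (2 * pi * (al * S b + ps))|
  <= n%:R ^+ n * (M%:R^-1 * \sum_(l < M) B l).
Proof.
move=> hB; have M0 : 0 < M%:R :> R by rewrite ltr0n.
rewrite dice_cos_sum normrM normfV (gtr0_norm M0) mulrCA ler_wpM2l //.
apply: le_trans (ler_norm_sum _ _ _) _; rewrite mulr_sumr.
by apply: ler_sum => l _; exact: hB.
Qed.

End Characteristic.

(** * Estimates from the decay of the characteristic function *)

Section Zones.
Variables (R : realType) (n : nat) (A : {ffun 'I_n -> 'I_n}).
Hypothesis n0 : (0 < n)%N.
Variables (x y dl : R).
Hypotheses (x0 : 0 <= x) (y0 : 0 <= y) (dl0 : 0 <= dl).
Implicit Types (b : {ffun 'I_n -> 'I_n}) (al be ps u : R).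
Local Notation normc := ComplexField.Normc.normc.
Local Notation g := (gdie R A).
Local Notation S := (score R A).
Local Notation T := (excess R).
Local Notation c := (centred R).
Local Notation M := (2 * n ^ 2).+1.
Local Notation W := (n%:R ^+ n : R).
Local Notation grid := (beta_grid R n).

Hypothesis far : forall al be, `|al| <= 2^-1 -> `|be| <= 2^-1 ->
  y <= `|al| \/ x <= `|be| -> normc (fhat A al be) ^+ n <= dl.

Let M0 : 0 < M%:R :> R. Proof. by rewrite ltr0n. Qed.
Let W0 : 0 < W. Proof. by rewrite exprn_gt0 // ltr0n. Qed.
(** A bound for the proportion of grid points with [|be| < x]: the grid is centred at index [n^2],
    and fewer than [x M + 1] indices lie on each side. *)
Let E := 2 * x + 2 / M%:R.
Let E0 : 0 <= E. Proof. by rewrite addr_ge0 ?mulr_ge0 ?invr_ge0 // ltW. Qed.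

Lemma normr_grid_le l : (l < M)%N -> `|grid l| <= 2^-1.
Proof.
move=> lM; rewrite /beta_grid normrM normfV (gtr0_norm M0) ler_pdivrMr //.
rewrite -[M%:R]natr1 natrM ler_norml.
have : l%:R <= 2 * (n ^ 2)%:R :> R by rewrite -natrM ler_nat.
have := ler0n R l => h1 h2; apply/andP; split; lra.
Qed.

Lemma count_grid : M%:R^-1 * \sum_(l < M) (`|grid l| < x)%R%:R <= E.
Proof.
have -> : \sum_(l < M) (`|grid l| < x)%R%:R
   = \sum_(l < M) (`|(n ^ 2)%:R - l%:R| < x * M%:R)%R%:R :> R.
  apply: eq_bigr => l _.
  by rewrite /beta_grid normrM normfV (gtr0_norm M0) ltr_pdivrMr // distrC.
have h1 := @sum_dist_le R (fun d => (d < x * M%:R)%R%:R) M (n ^ 2)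
  (fun d => ler0n _ _) ltac:(lia).
have h2 := @count_lt_le R M (x * M%:R) (mulr_ge0 x0 (ltW M0)).
rewrite mulrC ler_pdivrMr // /E mulrDl divfK ?gt_eqF //.
by apply: le_trans h1 _; lra.
Qed.

(** Where both frequencies are small the bound is the trivial 1, on a share at most [E] of the grid;
    everywhere else [far] gives [dl]. *)
Lemma dice_cos_zone al ps : `|al| <= 2^-1 ->
  `|\sum_(b in dice n) cos (2 * pi * (al * S b + ps))|
  <= W * ((`|al| < y)%R%:R * E + dl).
Proof.
move=> al1.
apply: (le_trans (@dice_cos_le R n A al ps
   (fun l => (`|al| < y)%R%:R * (`|grid l| < x)%R%:R + dl) _)).
  move=> l lM; apply: le_trans (sum_cos_le _ _ _ _ _) _ => //.
  rewrite ler_wpM2l ?(ltW W0) //.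
  have [aly|aly] := ltP; last first.
    by rewrite mul0r add0r; apply: far => //; [exact: normr_grid_le|left].
  have [bx|bx] := ltP; last first.
    by rewrite mulr0 add0r; apply: far => //; [exact: normr_grid_le|right].
  rewrite mul1r (@le_trans _ _ 1) ?lerDl // exprn_ile1 ?normc_fhat_le1 //.
  by case: (fhat A al (grid l)) => u v; rewrite sqrtr_ge0.
rewrite ler_wpM2l ?(ltW W0) //.
rewrite big_split /= sumr_const card_ord -mulr_sumr mulrDr.
rewrite -[dl *+ _]mulr_natl mulKf ?gt_eqF // lerD2r mulrCA ler_wpM2l //.
exact: count_grid.
Qed.

Section Kernel.
Variable K : nat.
Hypothesis K0 : (0 < K)%N.
Let K0' : 0 < K%:R :> R. Proof. by rewrite ltr0n. Qed.

Lemma freq_le (i j : 'I_K) : `|(i%:R - j%:R) / (2 * K%:R)| <= 2^-1 :> R.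
Proof.
rewrite normrM normfV (gtr0_norm (mulr_gt0 _ K0')) // ler_pdivrMr ?mulr_gt0 //.
rewrite mulKf ?pnatr_eq0 // ler_norml.
have := ltnW (ltn_ord i); have := ltnW (ltn_ord j); rewrite -!(ler_nat R).
have := ler0n R i; have := ler0n R j => ? ? ? ?; apply/andP; split; lra.
Qed.

(** The kernel is nonnegative with value [1/4] at 0, so four times it dominates the indicator. Of
    its frequencies a share at most [4 y + 2 / K] lies below [y], and only those incur [E]. *)
Lemma dice_point_le u :
  \sum_(b in dice n) (2 * S b == u)%:R
  <= W * ((4 * y + 2 / K%:R) * E + dl).
Proof.
apply: (@le_trans _ _ (\sum_(b in dice n) 4 * fejer K (2 * S b - u))).
  apply: ler_sum => b _; case: eqP => [->|_].
    by rewrite subrr fejer0 // divff // pnatr_eq0.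
  by rewrite mulr_ge0 // fejer_ge0.
rewrite -mulr_sumr /fejer -mulr_suml exchange_big /=.
under eq_bigr do rewrite exchange_big /=.
apply: (@le_trans _ _ (4 * ((\sum_(i < K) \sum_(j < K)
   W * ((`|i%:R - j%:R| < 2 * K%:R * y)%R%:R * E + dl)) / (4 * K%:R ^+ 2)))).
  rewrite ler_pM2l // ler_pM2r ?invr_gt0 ?mulr_gt0 ?exprn_gt0 //.
  apply: ler_sum => i _; apply: ler_sum => j _.
  have := dice_cos_zone (- ((i%:R - j%:R) * u / (4 * K%:R))) (freq_le i j).
  have -> : (`|(i%:R - j%:R) / (2 * K%:R)| < y :> R) =
      (`|i%:R - j%:R| < 2 * K%:R * y :> R).
    rewrite normrM normfV (gtr0_norm (mulr_gt0 _ K0')) //.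
    by rewrite ltr_pdivrMr ?mulr_gt0 // mulrC.
  apply: le_trans; apply: le_trans (ler_norm _).
  rewrite le_eqVlt; apply/orP; left; apply/eqP; apply: eq_bigr => b _.
  by congr cos; field; rewrite gt_eqF.
have -> : 4 * ((\sum_(i < K) \sum_(j < K)
   W * ((`|i%:R - j%:R| < 2 * K%:R * y)%R%:R * E + dl)) / (4 * K%:R ^+ 2))
  = W * ((\sum_(i < K) \sum_(j < K)
     ((`|i%:R - j%:R| < 2 * K%:R * y)%R%:R * E + dl)) / K%:R ^+ 2).
  rewrite [X in 4 * (X / _)](_ : _ = W * \sum_(i < K) \sum_(j < K)
     ((`|i%:R - j%:R| < 2 * K%:R * y)%R%:R * E + dl)).
    by field; rewrite gt_eqF.
  by rewrite mulr_sumr; apply: eq_bigr => i _; rewrite mulr_sumr.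
rewrite ler_pM2l // ler_pdivrMr ?exprn_gt0 //.
apply: (@le_trans _ _
    (\sum_(i < K) (2 * (2 * K%:R * y + 1) * E + K%:R * dl))).
  apply: ler_sum => i _.
  rewrite big_split /= sumr_const card_ord -[dl *+ K]mulr_natl lerD2r.
  rewrite -mulr_suml ler_wpM2r //.
  have h1 := @sum_dist_le R (fun d => (d < 2 * K%:R * y)%R%:R) K i
    (fun d => ler0n _ _) (ltn_ord i).
  apply: (le_trans h1); rewrite ler_pM2l //; apply: count_lt_le.
  by rewrite !mulr_ge0 // ltW.
rewrite sumr_const card_ord -[(_ + _) *+ K]mulr_natl.
have -> : ((4 * y + 2 / K%:R) * E + dl) * K%:R ^+ 2
  = K%:R * (2 * (2 * K%:R * y + 1) * E + K%:R * dl).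
  by field; rewrite gt_eqF.
by [].
Qed.

Variable et : R.
Hypothesis et0 : 0 <= et.
Hypothesis near : forall al be, `|al| < y -> `|be| < x ->
  n%:R * `|complex.Im (fhat A al be)| <= et.

(** As for [dice_cos_zone], but where both frequencies are small the sine sum is an imaginary part,
    and [near] gains the factor [et]. *)
Lemma dice_sin_zone al : `|al| <= 2^-1 ->
  `|\sum_(b in dice n) sin (2 * pi * (al * S b))| <= W * (E * et + dl).
Proof.
move=> al1.
have sinE z : sin (2 * pi * z) = cos (2 * pi * (z - 4^-1)).
  by rewrite -cosBpihalf; congr cos; field.
under eq_bigr do rewrite sinE.
apply: (le_trans (@dice_cos_le R n A al (- 4^-1)
   (fun l => (`|grid l| < x)%R%:R * et + dl) _)).
  move=> l lM.
  have far_case : y <= `|al| \/ x <= `|grid l| ->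
      `|\sum_b cos (2 * pi * (al * S b + grid l * T b - 4^-1))| <= W * dl.
    move=> h; apply: le_trans (sum_cos_le _ _ _ _ _) _ => //.
    rewrite ler_wpM2l ?(ltW W0) //.
    by apply: far => //; exact: normr_grid_le.
  have [bx|bx] := ltP; last by rewrite mul0r add0r; apply: far_case; right.
  rewrite mul1r; have [aly|aly] := ltP `|al| y; last first.
    apply: (@le_trans _ _ (W * dl)); first by apply: far_case; left.
    by rewrite ler_wpM2l ?lerDr // ltW.
  under eq_bigr do rewrite -sinE.
  apply: le_trans (sum_sin_le _ _ _ _) _ => //.
  rewrite ler_wpM2l ?(ltW W0) //.
  by apply: (@le_trans _ _ et); [exact: near | rewrite lerDl].
rewrite ler_wpM2l ?(ltW W0) //.
rewrite big_split /= sumr_const card_ord -mulr_suml mulrDr.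
rewrite -[dl *+ _]mulr_natl mulKf ?gt_eqF // lerD2r mulrA ler_wpM2r //.
exact: count_grid.
Qed.

(** The smoothed sign is odd, so its expansion has sines only and [dice_sin_zone] applies to every
    frequency; the [1 / |i - j|] decay of the coefficients produces the harmonic sum. *)
Lemma dice_sign_le :
  `|\sum_(b in dice n) smooth_sign K (2 * S b)|
  <= W * (42 * (\sum_(d < K) (d%:R : R)^-1) * (E * et + dl)).
Proof.
set H := \sum_(d < K) _.
under eq_bigr do rewrite smooth_sign_expand.
rewrite -mulr_suml exchange_big /=.
under eq_bigr do rewrite exchange_big /=.
have D0 : 0 < 4 * K%:R ^+ 2 :> R by rewrite mulr_gt0 ?exprn_gt0.
rewrite normrM normfV (gtr0_norm D0) ler_pdivrMr //.
apply: le_trans (ler_norm_sum _ _ _) _.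
(* Here [84] is twice the [42] of [sign_coef_le], and [2 * H] counts distances on both sides;
   summing over [i] and dividing by [4 K^2] leaves [42 * H]. *)
apply: (@le_trans _ _ (\sum_(i < K) 84 * K%:R * (W * (E * et + dl)) * (2 * H))).
  apply: ler_sum => i _; apply: le_trans (ler_norm_sum _ _ _) _.
  apply: (@le_trans _ _ (\sum_(j < K)
      84 * K%:R * (W * (E * et + dl)) * `|i%:R - j%:R|^-1)); last first.
    rewrite -mulr_sumr ler_wpM2l //.
      rewrite !mulr_ge0 ?ler0n ?addr_ge0 ?mulr_ge0 //; exact: ltW.
    by apply: (@sum_dist_le R GRing.inv) => [d|//]; rewrite invr_ge0.
  apply: ler_sum => j _.
  rewrite -mulr_sumr normrM.
  have [->|ij] := eqVneq (i%:R - j%:R : R) 0.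
    by rewrite sign_coef0 mulr0 !normr0 mul0r invr0 mulr0.
  have hs := dice_sin_zone (freq_le i j).
  have -> : \sum_(b in dice n)
       sin ((i%:R - j%:R) * (pi * (2 * S b) / (2 * K%:R)))
     = \sum_(b in dice n) sin (2 * pi * ((i%:R - j%:R) / (2 * K%:R) * S b)).
    by apply: eq_bigr => b _; congr sin; field; rewrite gt_eqF.
  have hq : `|2 * sign_coef K (i%:R - j%:R)|
      <= 84 * K%:R * `|i%:R - j%:R|^-1 :> R.
    rewrite normrM ger0_norm //.
    have := @sign_coef_le R K (i%:R - j%:R).
    rewrite normr_gt0 ij /= => /(_ _).
    have : `|i%:R - j%:R| <= K%:R :> R.
      have := freq_le i j.
      rewrite normrM normfV (gtr0_norm (mulr_gt0 _ K0')) //.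
      by rewrite ler_pdivrMr ?mulr_gt0 // mulKf ?pnatr_eq0.
    move=> h /(_ h); lra.
  rewrite [leRHS](_ : _ =
     (84 * K%:R * `|i%:R - j%:R|^-1) * (W * (E * et + dl))); last by ring.
  by apply: ler_pM.
rewrite sumr_const card_ord -[(_ * _) *+ K]mulr_natl le_eqVlt.
apply/orP; left; apply/eqP.
ring.
Qed.

End Kernel.

End Zones.

(** * Number of dice and reduction to the smoothed sign *)

Section LowerBound.
Variables (R : realType) (n : nat).
Hypothesis n0 : (0 < n)%N.
Implicit Types (b : {ffun 'I_n -> 'I_n}) (be q x dl : R).
Local Notation normc := ComplexField.Normc.normc.
Local Notation T := (excess R).
Local Notation c := (centred R).
Local Notation M := (2 * n ^ 2).+1.
Local Notation W := (n%:R ^+ n : R).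
Local Notation grid := (beta_grid R n).

(** Reversing the order of the faces negates [c]; hence the characteristic function of the excess is
    real. *)
Lemma sum_sin_centred be : \sum_(j < n) sin (2 * pi * (be * c j)) = 0.
Proof.
set X := \sum_(j < n) _; suff : X = - X by lra.
rewrite /X {1}(reindex_inj rev_ord_inj) /= -sumrN; apply: eq_bigr => j _.
rewrite -sinN; congr sin; rewrite /centred /pip /= subnSK // natrB.
  by rewrite -[j.+1%:R]natr1; field.
exact: ltnW.
Qed.

Lemma sum_cos_excess be :
  \sum_(b : {ffun 'I_n -> 'I_n}) cos (2 * pi * (be * T b))
  = (\sum_(j < n) cos (2 * pi * (be * c j))) ^+ n.
Proof.
(* At [al = 0] the score drops out, so an arbitrary [A] gives access to [sum_e2pi]. *)
pose A : {ffun 'I_n -> 'I_n} := [ffun i => i].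
have e (b : {ffun 'I_n -> 'I_n}) : cos (2 * pi * (be * T b))
    = complex.Re (e2pi (0 * score R A b + be * T b)) by rewrite mul0r add0r.
under eq_bigr do rewrite e.
rewrite -Re_sum sum_e2pi // natr_fhat //.
have -> : \sum_(j < n) e2pi (0 * gdie R A j + be * c j)
   = real_complex R (\sum_(j < n) cos (2 * pi * (be * c j))).
  apply/eqP; rewrite eq_complex Re_sum Im_sum /=.
  under eq_bigr do rewrite mul0r add0r.
  rewrite eqxx /=; under eq_bigr do rewrite mul0r add0r.
  by rewrite sum_sin_centred.
by rewrite -rmorphXn.
Qed.

Lemma bernoulli_ge q (m : nat) : 0 <= q <= 1 -> 1 - m%:R * q <= (1 - q) ^+ m.
Proof.
move=> /andP[q0 q1]; elim: m => [|m IH]; first by rewrite mul0r subr0 expr0.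
rewrite exprS -natr1; apply: (@le_trans _ _ ((1 - q) * (1 - m%:R * q))).
  have : 0 <= m%:R * q * q by rewrite !mulr_ge0.
  lra.
by rewrite ler_wpM2l // subr_ge0.
Qed.

(** Each cosine is at least [1 - q] because [2 |c j| <= n], and Bernoulli's inequality handles the
    power. *)
Lemma sum_cos_excess_ge be (q := (pi * be * n%:R) ^+ 2 / 2) : q <= 2^-1 ->
  W * (1 - n%:R * q)
  <= \sum_(b : {ffun 'I_n -> 'I_n}) cos (2 * pi * (be * T b)).
Proof.
move=> q1; have q0 : 0 <= q by rewrite divr_ge0 // sqr_ge0.
rewrite sum_cos_excess.
apply: (@le_trans _ _ ((n%:R * (1 - q)) ^+ n)).
  rewrite exprMn ler_wpM2l ?exprn_ge0 // bernoulli_ge // q0 /=; lra.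
have nq0 : 0 <= n%:R * (1 - q) by rewrite mulr_ge0 //; lra.
suff h : n%:R * (1 - q) <= \sum_(j < n) cos (2 * pi * (be * c j)).
  by rewrite lerXn2r ?nnegrE // (le_trans nq0).
rewrite mulr_natl -[X in _ *+ X]card_ord -sumr_const; apply: ler_sum => j _.
apply: le_trans (cos_ge _).
rewrite lerD2l lerN2 ler_pM2r ?invr_gt0 //.
rewrite -(real_normK (num_real (2 * _ * _))).
rewrite -(real_normK (num_real (pi * _ * _))).
rewrite lerXn2r ?nnegrE //.
rewrite !normrM (ger0_norm (pi_ge0 R)) !normr_nat.
have := normr_centred_le R j; move: (`|c j|) => z hz.
have -> : 2 * pi * (`|be| * z) = pi * `|be| * (2 * z) by ring.
by rewrite ler_wpM2l ?mulr_ge0 ?pi_ge0 //; lra.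
Qed.

(** Fourier inversion over the grid with three kinds of points: [r + 1] frequencies near zero give
    at least [W / 2] each, those with [|be| >= x] lose at most [W * dl], and the rest are
    nonnegative. *)
Lemma card_dice_ge (A : {ffun 'I_n -> 'I_n}) (x dl : R) (r : nat) :
  0 <= dl -> pi * x * n%:R <= 1 -> (4 * r ^ 2 <= n)%N ->
  (forall be, `|be| <= 2^-1 -> x <= `|be| -> normc (fhat A 0 be) ^+ n <= dl) ->
  W * (r.+1%:R / (2 * M%:R) - dl) <= #|dice n|%:R.
Proof.
move=> dl0 hx hr far; have M0 : 0 < M%:R :> R by rewrite ltr0n.
have W0 : 0 <= W by rewrite exprn_ge0.
have n0' : 0 < n%:R :> R by rewrite ltr0n.
(* Index [n^2] is frequency zero; [I] selects it and the next [r] positive frequencies. *)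
pose I (l : nat) := (n ^ 2 <= l < n ^ 2 + r.+1)%N.
have term l : (l < M)%N -> W * ((I l)%:R / 2 - dl)
    <= \sum_(b : {ffun 'I_n -> 'I_n}) cos (2 * pi * (grid l * T b)).
  move=> lM; case: (boolP (I l)) => [/andP[l1 l2]|_].
    have hq : n%:R * (pi * grid l * n%:R) ^+ 2 <= 1.
      have -> : n%:R * (pi * grid l * n%:R) ^+ 2
         = pi ^+ 2 * n%:R ^+ 3 * grid l ^+ 2 by ring.
      rewrite /beta_grid expr_div_n mulrA ler_pdivrMr ?exprn_gt0 // mul1r.
      apply: (@le_trans _ _ (16 * n%:R ^+ 3 * (n%:R / 4))).
        apply: ler_pM.
        + by rewrite mulr_ge0 ?exprn_ge0 // pi_ge0.
        + exact: sqr_ge0.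
        + rewrite ler_wpM2r ?exprn_ge0 //.
          have := pi_ge0 R; have := pihalf_lt2 R; nra.
        rewrite -natrB // ler_pdivlMr // -natrX -natrM ler_nat mulnC.
        apply: leq_trans hr; rewrite leq_mul2l /= leq_exp2r //; lia.
      have -> : 16 * n%:R ^+ 3 * (n%:R / 4) = (2 * n%:R ^+ 2) ^+ 2 :> R.
        by field.
      rewrite lerXn2r ?nnegrE ?mulr_ge0 ?exprn_ge0 // -natrX -natrM ler_nat.
      lia.
    apply: le_trans (sum_cos_excess_ge _); last first.
      have n1 : 1 <= n%:R :> R by rewrite ler1n.
      have := sqr_ge0 (pi * grid l * n%:R); nra.
    rewrite ler_wpM2l //= mulrA. lra.
  have [bx|bx] := leP x `|grid l|.
    have := sum_cos_le A n0 0 (grid l) 0.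
    under eq_bigr do rewrite mul0r add0r addr0.
    have := far _ (normr_grid_le R lM) bx.
    move=> /(ler_wpM2l W0) h1 h2; have := le_trans h2 h1.
    by rewrite ler_norml mul0r sub0r mulrN => /andP[].
  (* Here [pi * x * n <= 1] keeps every angle within 1, so all the cosines are nonnegative. *)
  apply: (@le_trans _ _ 0).
    by rewrite mulr_ge0_le0 //= mul0r sub0r oppr_le0.
  rewrite sum_cos_excess exprn_ge0 // sumr_ge0 // => j _.
  move: (grid l) bx => be bx.
  apply: le_trans (cos_ge _).
  have pi0 := pi_gt0 R.
  have h : `|2 * pi * (be * c j)| <= 1.
    rewrite !normrM (gtr0_norm pi0) normr_nat.
    apply: le_trans hx; have := normr_centred_le R j.
    have -> : 2 * pi * (`|be| * `|c j|) = pi * (`|be| * (2 * `|c j|)).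
      ring.
    move=> hc; rewrite -mulrA ler_pM2l //; apply: ler_pM => //.
      exact: ltW.
    lra.
  have : `|2 * pi * (be * c j)| ^+ 2 <= 1 by rewrite exprn_ile1.
  rewrite real_normK ?num_real //; lra.
have -> : #|dice n|%:R = M%:R^-1 * \sum_(l < M)
   \sum_(b : {ffun 'I_n -> 'I_n}) cos (2 * pi * (grid l * T b)) :> R.
  have := dice_cos_sum A (0 : R) 0.
  under eq_bigr do rewrite mul0r add0r mulr0 cos0.
  rewrite sumr_const => ->; congr (_ * _); apply: eq_bigr => l _.
  by apply: eq_bigr => b _; rewrite mul0r add0r addr0.
rewrite [leRHS]mulrC ler_pdivlMr //.
apply: (@le_trans _ _ (\sum_(l < M) W * ((I l)%:R / 2 - dl))); last first.
  by apply: ler_sum => l _; exact: term.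
rewrite -mulr_sumr -mulrA ler_wpM2l // sumrB sumr_const card_ord -mulr_suml.
have : r.+1%:R <= \sum_(l < M) (I l)%:R :> R.
  rewrite -(big_mkord xpredT (fun l => (I l)%:R)).
  have rn : (n ^ 2 + r.+1 <= M)%N by nia.
  rewrite (big_cat_nat (n := n ^ 2)) //=; last by lia.
  rewrite [X in _ + X](big_cat_nat (n := n ^ 2 + r.+1)) //= ?leq_addr //.
  rewrite [X in _ + (X + _)](eq_big_nat _ _ (F2 := fun=> 1)); last first.
    by move=> l; rewrite /I => ->.
  rewrite sumr_const_nat addKn.
  have h1 : 0 <= \sum_(0 <= i < n ^ 2) (I i)%:R :> R by rewrite sumr_ge0.
  have h2 : 0 <= \sum_(n ^ 2 + r.+1 <= i < M) (I i)%:R :> R by rewrite sumr_ge0.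
  lra.
rewrite -[dl *+ _]mulr_natl.
have -> : (r.+1%:R / (2 * M%:R) - dl) * M%:R = r.+1%:R / 2 - M%:R * dl :> R.
  by field; rewrite gt_eqF.
lra.
Qed.

End LowerBound.

(** * From the smoothed sign to the probability of beating *)

Section Probability.
Variables (R : realType) (n : nat) (A : {ffun 'I_n -> 'I_n}).
Local Notation S := (score R A).

Lemma prob_beatsE :
  prob_beats R A = (\sum_(b in dice n) (S b < 0)%R%:R) / #|dice n|%:R.
Proof.
rewrite /prob_beats -sum1dep_card natr_sum big_mkcondr; congr (_ / _).
by apply: eq_bigr => b bd; rewrite (beats_score R A bd); case: ltP.
Qed.

(** The indicator of [S < 0] is [1/2] minus half the smoothed sign, with error at most [882 / m]
    when [|2 S| > m] and at most 1 otherwise. The latter case concerns only the [2 m + 1] values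
    allowed for the integer [2 S]. *)
Lemma prob_beats_le (K m : nat) (W p E1 E2 : R) :
  (0 < K)%N -> (0 < m)%N -> 0 < W -> 0 < p -> W * p <= #|dice n|%:R ->
  (forall b, `|2 * S b| <= K%:R / 2) ->
  (forall u, \sum_(b in dice n) (2 * S b == u)%:R <= W * E1) ->
  `|\sum_(b in dice n) smooth_sign K (2 * S b)| <= W * E2 ->
  `|prob_beats R A - 2^-1|
    <= (E2 / 2 + (2 * m).+1%:R * E1) / p + 882 / m%:R.
Proof.
move=> K0 m0 W0 p0 hD SK hE1 hE2.
have m0' : 0 < m%:R :> R by rewrite ltr0n.
set D : R := #|dice n|%:R in hD *.
have D0 : 0 < D by apply: lt_le_trans hD; rewrite mulr_gt0.
have point b : `|(S b < 0)%R%:R - 2^-1 + smooth_sign K (2 * S b) / 2|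
    <= (`|2 * S b| <= m%:R)%R%:R + 882 / m%:R.
  set u := 2 * S b.
  have u0 : (S b < 0) = (u < 0) by rewrite /u pmulr_rlt0.
  have := smooth_sign_le1 u K0; rewrite u0.
  have m882 : 0 <= 882 / m%:R :> R by rewrite divr_ge0 ?ler0n.
  have [um|um] := leP `|u| m%:R.
    rewrite ler_norml => /andP[h1 h2].
    apply: (@le_trans _ _ 1); last by rewrite lerDl.
    rewrite ler_norml; case: ltP => _ /=; apply/andP; split; lra.
  move=> _; rewrite add0r.
  have uK := SK b; rewrite -/u in uK.
  have gen (w : R) : m%:R < w -> w <= K%:R / 2 ->
      `|smooth_sign K w - 1| / 2 <= 882 / m%:R.
    move=> mw wK; have w0 : 0 < w by exact: lt_trans m0' mw.
    have := @smooth_sign_near R K w K0; rewrite w0 wK => /(_ isT) h.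
    rewrite ler_pdivrMr //; apply: le_trans h _.
    have -> : 882 / m%:R * 2 = 1764 / m%:R :> R by ring.
    by rewrite ler_wpM2l ?ler0n // lef_pV2 ?posrE // ltW.
  have [u1|u1] := ltP u 0.
    rewrite ltr0_norm // in um uK; have := gen _ um uK; rewrite smooth_signN.
    apply: le_trans.
    have -> : true%:R - 2^-1 + smooth_sign K u / 2
      = - ((- smooth_sign K u - 1) / 2) by rewrite /=; field.
    by rewrite normrN normrM normfV normr_nat.
  rewrite ger0_norm // in um uK; have := gen _ um uK.
  apply: le_trans.
  have -> : false%:R - 2^-1 + smooth_sign K u / 2 = (smooth_sign K u - 1) / 2.
    by rewrite /=; field.
  by rewrite normrM normfV normr_nat.
have small : \sum_(b in dice n) (`|2 * S b| <= m%:R)%R%:R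
    <= (2 * m).+1%:R * (W * E1).
  apply: (@le_trans _ _ (\sum_(v < (2 * m).+1)
      \sum_(b in dice n) (2 * S b == v%:R - m%:R)%:R)).
    rewrite exchange_big /=; apply: ler_sum => b _.
    have [bm|_] := leP `|2 * S b| m%:R; last by apply: sumr_ge0.
    (* [2 * S b] is an integer [z] in [[-m, m]], met in the outer sum at index [z + m]. *)
    have /intrP[z hz] := score_half_int R A b.
    have zm : (`|z| <= m%:Z)%R.
      by move: bm; rewrite hz -intr_norm -[m%:R]/(m%:Z%:~R) ler_int.
    have vm : (absz (z + m%:Z)%R < (2 * m).+1)%N by lia.
    rewrite (bigD1 (Ordinal vm)) //= (_ : _ == _) ?lerDl ?sumr_ge0 //.
    rewrite hz -[(absz _)%:R]/((absz (z + m%:Z))%:Z%:~R) gez0_abs; last by lia.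
    by rewrite intrD addrK.
  apply: (@le_trans _ _ (\sum_(v < (2 * m).+1) W * E1)).
    by apply: ler_sum => v _.
  by rewrite sumr_const card_ord mulr_natl.
pose N : R := \sum_(b in dice n) (S b < 0)%R%:R.
have key : `|N - D / 2 + (\sum_(b in dice n) smooth_sign K (2 * S b)) / 2|
    <= (2 * m).+1%:R * (W * E1) + D * (882 / m%:R).
  have -> : N - D / 2 + (\sum_(b in dice n) smooth_sign K (2 * S b)) / 2
    = \sum_(b in dice n) ((S b < 0)%R%:R - 2^-1 + smooth_sign K (2 * S b) / 2).
    rewrite big_split /= sumrB sumr_const -mulr_suml /D.
    by rewrite -[2^-1 *+ _]mulr_natl.
  apply: le_trans (ler_norm_sum _ _ _) _.
  apply: le_trans (ler_sum _ (fun b _ => point b)) _.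
  by rewrite big_split /= sumr_const -[(_ / _) *+ _]mulr_natl lerD2r.
rewrite prob_beatsE -/N -/D.
have -> : N / D - 2^-1 = (N - D / 2) / D by field; rewrite gt_eqF.
rewrite normrM normfV (gtr0_norm D0) ler_pdivrMr //.
have hWD : W * (E2 / 2 + (2 * m).+1%:R * E1)
    <= (E2 / 2 + (2 * m).+1%:R * E1) / p * D.
  rewrite mulrC -[leRHS]mulrA; apply: ler_wpM2l.
    rewrite -(pmulr_rge0 _ W0) mulrDr addr_ge0 //.
      have : 0 <= W * E2 by apply: le_trans hE2.
      by rewrite mulrA => h; rewrite divr_ge0.
    rewrite mulrCA mulr_ge0 //; apply: le_trans (hE1 0); exact: sumr_ge0.
  by rewrite mulrC ler_pdivlMr.
apply: (@le_trans _ _ (`|N - D / 2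
    + (\sum_(b in dice n) smooth_sign K (2 * S b)) / 2|
    + `|\sum_(b in dice n) smooth_sign K (2 * S b)| / 2)).
  rewrite -[X in _ <= _ + X](_ :
    `|(\sum_(b in dice n) smooth_sign K (2 * S b)) / 2| = _); last first.
    by rewrite normrM normfV normr_nat.
  by apply: le_trans (ler_normB _ _); rewrite addrK.
lra.
Qed.

End Probability.

(** * Asymptotics *)

Section Large.
Variables (R : realType) (n : nat) (A : {ffun 'I_n -> 'I_n}) (v : R).
Local Notation N := (n%:R : R).
Local Notation normc := ComplexField.Normc.normc.
Hypotheses (v0 : 0 < v) (v1 : 10 ^+ 10 * v <= 1).
Hypotheses (nv : N * v ^+ 80 = 1) (lnv : ln N * v ^+ 2 <= 1).

Let small (c : R) : 0 <= c <= 10 ^+ 10 -> c * v <= 1.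
Proof.
by move=> /andP[c0 c1]; apply: le_trans v1; rewrite ler_wpM2r // ltW.
Qed.

Let v_le1 : v <= 1.
Proof. by rewrite -[v]mul1r; apply: small; apply/andP; split; lra. Qed.

Let vX (i j : nat) : (j <= i)%N -> v ^+ i <= v ^+ j.
Proof. by move=> ji; apply: ler_wiXn2l => //; exact: ltW. Qed.

Let vX0 (i : nat) : 0 < v ^+ i. Proof. exact: exprn_gt0. Qed.

(** One spare power of [v] pays for any constant up to [10^10]. *)
Let absorb (c : R) (i : nat) : 0 <= c <= 10 ^+ 10 -> c * v ^+ i.+1 <= v ^+ i.
Proof.
by move=> hc; rewrite exprS mulrA ler_piMl ?small // ltW.
Qed.

Let N0 : 0 < N.
Proof. by rewrite -(pmulr_lgt0 _ (vX0 80)) nv. Qed.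

Let invN : N^-1 = v ^+ 80.
Proof. by apply: (mulfI (lt0r_neq0 N0)); rewrite divff ?gt_eqF ?nv. Qed.

Let N_ge (k : nat) : (k <= 79)%N -> 10 ^+ 10 <= N * v ^+ k.
Proof.
move=> k79; rewrite -(ler_pM2r v0); apply: le_trans v1 _.
rewrite -mulrA -exprSr; apply: (@le_trans _ _ (N * v ^+ 80)).
  by rewrite nv.
by rewrite ler_wpM2l ?(ltW N0) // vX.
Qed.

(** Of the 80 powers in [1 / N = v^80], two pay for the logarithm and one for the constant. *)
Lemma zone_alpha : 10 ^+ 7 * ln N / N <= v ^+ 77.
Proof.
have N1 : 1 <= N.
  have := N_ge (leq0n _); rewrite expr0 mulr1; apply: le_trans; lra.
have l0 : 0 <= ln N by exact: ln_ge0.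
have -> : 10 ^+ 7 * ln N / N = (10 ^+ 7 * v) * (ln N * v ^+ 2) * v ^+ 77.
  by rewrite invN; ring.
rewrite ler_piMl ?(ltW (vX0 _)) //; apply: mulr_ile1 => //.
- by rewrite mulr_ge0 ?exprn_ge0 // ltW.
- by rewrite mulr_ge0 // ltW.
by apply: small; apply/andP; split; lra.
Qed.

(** [(v^78)^(3/2) = v^117], and one power absorbs [10^9]. *)
Lemma zone_beta : 10 ^+ 9 * (ln N / N) `^ (3 / 2) <= v ^+ 116.
Proof.
have N1 : 1 <= N.
  have := N_ge (leq0n _); rewrite expr0 mulr1; apply: le_trans; lra.
have l0 : 0 <= ln N by exact: ln_ge0.
have h : ln N / N <= v ^+ 78.
  have -> : ln N / N = ln N * v ^+ 2 * v ^+ 78 by rewrite invN; ring.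
  by rewrite ler_piMl // ltW.
apply: (@le_trans _ _ (10 ^+ 9 * v ^+ 117)); last first.
  by apply: absorb; apply/andP; split; lra.
rewrite ler_wpM2l ?exprn_ge0 //.
have -> : v ^+ 117 = (v ^+ 78) `^ (3 / 2).
  rewrite -!powR_mulrn ?(ltW v0) // -powRrM; congr (_ `^ _); lra.
apply: ge0_ler_powR => //; rewrite ?nnegrE ?exprn_ge0 ?(ltW v0) //.
by rewrite divr_ge0 ?(ltW N0).
Qed.

Lemma sqrt_large : Num.sqrt (N * ln N) <= N * v ^+ 39.
Proof.
have Nv0 : 0 <= N * v ^+ 39 by rewrite mulr_ge0 ?exprn_ge0 ?(ltW v0) ?(ltW N0).
rewrite -(ger0_norm Nv0) -sqrtr_sqr ler_wsqrtr //.
have -> : (N * v ^+ 39) ^+ 2 = N * (N * v ^+ 80 * v ^- 2).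
  by field; rewrite gt_eqF.
by rewrite nv ler_pM2l // ler_pdivlMr ?exprn_gt0.
Qed.

Hypotheses (Ad : A \in dice n).
Hypothesis gmax :
  \big[Num.max/0]_(j < n) `|gdie R A j| <= 2 * Num.sqrt (N * ln N).
Hypothesis decay : forall alpha beta : R,
  - 2^-1 <= alpha <= 2^-1 -> - 2^-1 <= beta <= 2^-1 ->
  `|alpha| >= 10 ^+ 7 * ln N / N \/
  `|beta| >= 10 ^+ 9 * (ln N / N) `^ (3 / 2) ->
  normc (fhat A alpha beta) ^+ n <= N ^- 10.

Let n0 : (0 < n)%N. Proof. by rewrite -(ltr0n R). Qed.

Let g_le j : `|gdie R A j| <= 2 * (N * v ^+ 39).
Proof.
move: gmax => /bigmax_leP[_ /(_ j isT)] h.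
by apply: (le_trans h); rewrite ler_pM2l // sqrt_large.
Qed.

Let far al be : `|al| <= 2^-1 -> `|be| <= 2^-1 ->
  v ^+ 77 <= `|al| \/ v ^+ 116 <= `|be| ->
  normc (fhat A al be) ^+ n <= v ^+ 800.
Proof.
rewrite !ler_norml => al1 be1 h.
have -> : v ^+ 800 = N ^- 10 by rewrite -exprVn invN -exprM.
apply: decay => //; case: h => h; [left|right]; apply: le_trans h.
  exact: zone_alpha.
exact: zone_beta.
Qed.

(** Both [al * g] and [be * c] are of order [v^36], so the angle is at most [20 v^36 <= v^35]; its
    cube times [N = v^-80] is [v^25]. *)
Let near al be : `|al| < v ^+ 77 -> `|be| < v ^+ 116 ->
  N * `|complex.Im (fhat A al be)| <= v ^+ 25.
Proof.
move=> al1 be1.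
have -> : v ^+ 25 = N * (v ^+ 35) ^+ 3.
  have -> : N * (v ^+ 35) ^+ 3 = N * v ^+ 80 * v ^+ 25 by ring.
  by rewrite nv mul1r.
rewrite ler_pM2l //; apply: normr_Im_fhat_le => // j.
have pi4 : pi <= 4 :> R by have := pihalf_lt2 R; lra.
have p1 : `|al * gdie R A j| <= 2 * v ^+ 36.
  rewrite normrM.
  have -> : 2 * v ^+ 36 = v ^+ 77 * (2 * (N * v ^+ 39)).
    have -> : v ^+ 77 * (2 * (N * v ^+ 39)) = 2 * (N * v ^+ 80 * v ^+ 36).
      by ring.
    by rewrite nv mul1r.
  by apply: ler_pM => //; exact: ltW.
have p2 : `|be * centred R j| <= v ^+ 36 / 2.
  rewrite normrM.
  have -> : v ^+ 36 / 2 = v ^+ 116 * (N / 2).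
    have -> : v ^+ 116 * (N / 2) = N * v ^+ 80 * v ^+ 36 / 2 by ring.
    by rewrite nv mul1r.
  by apply: ler_pM => //; [exact: ltW | exact: normr_centred_le].
rewrite !normrM normr_nat (ger0_norm (pi_ge0 R)).
apply: (@le_trans _ _ (2 * 4 * (2 * v ^+ 36 + v ^+ 36 / 2))).
  apply: ler_pM => //; first by rewrite mulr_ge0 // pi_ge0.
    by rewrite ler_pM2l.
  by apply: le_trans (ler_normD _ _) _; exact: lerD.
have -> : 2 * 4 * (2 * v ^+ 36 + v ^+ 36 / 2) = 20 * v ^+ 36 by field.
by apply: absorb; apply/andP; split; lra.
Qed.

Let M := (2 * n ^ 2).+1.
Let ME : M%:R = 2 * N ^+ 2 + 1. Proof. by rewrite /M -natr1 natrM natrX. Qed.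

Let N1 : 1 <= N. Proof. by rewrite ler1n. Qed.

Let invM : 2 / M%:R <= v ^+ 160.
Proof.
have -> : v ^+ 160 = (N ^+ 2)^-1 by rewrite -exprVn invN -exprM.
rewrite ME ler_pdivrMr; last by rewrite ltr_wpDl ?mulr_ge0 ?exprn_ge0.
rewrite mulrC ler_pdivlMr ?exprn_gt0 //; lra.
Qed.

Let E_le : 2 * v ^+ 116 + 2 / M%:R <= 3 * v ^+ 116.
Proof. have := vX (isT : (116 <= 160)%N); have := invM; lra. Qed.

Lemma card_dice_large : N ^+ n * (v ^+ 120 / 24) <= #|dice n|%:R.
Proof.
(* Since [N * v^40] is the square root of [n], this is the largest [r] with [4 r^2 <= n]. *)
pose r := Num.trunc (N * v ^+ 40 / 2).
have q0 : 0 <= N * v ^+ 40 / 2.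
  by rewrite divr_ge0 // mulr_ge0 ?exprn_ge0 ?(ltW v0) ?(ltW N0).
have /andP[r1 r2] := truncn_itv q0; rewrite -/r in r1 r2.
have hr : (4 * r ^ 2 <= n)%N.
  rewrite -(ler_nat R) natrM natrX.
  have -> : N = 4 * (N * v ^+ 40 / 2) ^+ 2.
    have -> : 4 * (N * v ^+ 40 / 2) ^+ 2 = N * (N * v ^+ 80) by field.
    by rewrite nv mulr1.
  by rewrite ler_pM2l // lerXn2r ?nnegrE.
have hx : pi * v ^+ 116 * N <= 1.
  have -> : pi * v ^+ 116 * N = pi * v ^+ 35 * v * (N * v ^+ 80) by ring.
  rewrite nv mulr1; have pi4 : pi <= 4 :> R by have := pihalf_lt2 R; lra.
  rewrite mulrAC; apply: mulr_ile1;
    rewrite ?mulr_ge0 ?pi_ge0 ?exprn_ge0 ?(ltW v0) //.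
    apply: (@le_trans _ _ (4 * v)); first by rewrite ler_wpM2r // ltW.
    by apply: small; apply/andP; split; lra.
  by rewrite exprn_ile1 // ltW.
apply: le_trans (card_dice_ge n0 (exprn_ge0 800 (ltW v0)) hx hr _); last first.
  move=> be be1 be2; apply: far => //; last by right.
  by rewrite normr0 invr_ge0.
rewrite ler_wpM2l ?exprn_ge0 ?(ltW N0) //.
have M0 : 0 < M%:R :> R by rewrite ltr0n.
have h1 : v ^+ 120 / 12 <= r.+1%:R / (2 * M%:R).
  rewrite ler_pdivlMr ?mulr_gt0 //; apply: le_trans (ltW r2).
  have N2 : 1 <= N ^+ 2 by rewrite exprn_ege1.
  apply: (@le_trans _ _ (v ^+ 120 / 12 * (2 * (3 * N ^+ 2)))).
    rewrite ler_wpM2l ?divr_ge0 ?exprn_ge0 ?(ltW v0) // ler_pM2l //.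
    rewrite ME; lra.
  have -> : v ^+ 120 / 12 * (2 * (3 * N ^+ 2))
    = (N * v ^+ 80) * (N * v ^+ 40) / 2.
    by field.
  by rewrite nv mul1r.
have h2 : 24 * v ^+ 800 <= v ^+ 120.
  apply: (@le_trans _ _ (24 * v ^+ 121)); first by rewrite ler_pM2l // vX.
  by apply: absorb; apply/andP; split; lra.
rewrite -/M; lra.
Qed.

(** Large enough that [|2 S| <= K / 2], where the smoothed sign is accurate, and that
    [2 / K <= v^77]; still polynomial in [n], so the harmonic sum is logarithmic. *)
Let K := (4 * n ^ 2)%N.

Lemma harmonic_large : \sum_(d < K) (d%:R : R)^-1 <= 4 * v ^- 2.
Proof.
have n4 : (4 <= n)%N.
  rewrite -(ler_nat R); have := N_ge (leq0n _); rewrite expr0 mulr1.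
  by apply: le_trans; lra.
have [m Km] : exists m, K = m.+2.
  have K1 : (1 < K)%N by rewrite (@leq_trans 4) // leq_pmulr // expn_gt0 n0.
  by exists K.-2; rewrite prednK ?prednK // -?subn1 ?subn_gt0 // ltnW.
rewrite Km; apply: le_trans (harmonic_le R m) _.
have h1 : ln m.+1%:R <= 3 * ln N.
  rewrite [leRHS]mulr_natl -lnXn // ler_ln ?posrE ?ltr0n ?exprn_gt0 //.
  by rewrite -natrX ler_nat -ltnS -Km ltnW // ltnS /K expnS leq_mul2r n4 orbT.
have h2 : ln N <= v ^- 2 by rewrite -[_ ^- _]mul1r ler_pdivlMr.
have h3 : 1 <= v ^- 2.
  by rewrite -[_ ^- _]mul1r ler_pdivlMr // mul1r exprn_ile1 // ltW.
lra.
Qed.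

(** Point masses are of order [v^193] and the smoothed sign sum of order [v^139], against a dice
    count of order [v^120]. After division these give [v^72] and [v^19], so the smoothing error
    [882 / m <= 882 v] dominates. *)
Lemma prob_beats_large : `|prob_beats R A - 2^-1| <= 10 ^+ 5 * v.
Proof.
have K0 : (0 < K)%N by rewrite /K muln_gt0 expn_gt0 n0.
have KE : K%:R = 4 * N ^+ 2 by rewrite /K natrM natrX.
have W0 : 0 < N ^+ n by rewrite exprn_gt0.
(* The cutoff [m] is about [1 / v]: the smoothing error becomes a multiple of [v], while the
   [2 m + 1] point masses lose only one power of [v]. *)
pose m := (Num.trunc v^-1).+1.
have iv0 : 0 <= v^-1 by rewrite invr_ge0 ltW.
have m1 : v^-1 <= m%:R by exact/ltW/truncnS_gt.
have iv1 : 1 <= v^-1 by rewrite invf_ge1.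
have m2 : (2 * m).+1%:R <= 5 * v^-1.
  have /andP[t1 _] := truncn_itv iv0.
  by rewrite -natr1 natrM /m -[_.+1%:R]natr1; lra.
have SK b : `|2 * score R A b| <= K%:R / 2.
  rewrite normrM normr_nat KE.
  have := @normr_score_le R n A b _ g_le.
  have -> : N * (2 * (N * v ^+ 39)) = N ^+ 2 * (2 * v ^+ 38 * v) by ring.
  have : 2 * v ^+ 38 * v <= 1.
    rewrite -mulrA -exprSr; apply: le_trans (absorb _ _) _ => //.
      by apply/andP; split; lra.
    by rewrite exprn_ile1 // ltW.
  move=> /(ler_wpM2l (exprn_ge0 2 (ltW N0))); lra.
have x0 (i : nat) : 0 <= v ^+ i by exact/ltW.
have hE1 := dice_point_le n0 (x0 116%N) (x0 77%N) (x0 800%N) far K0.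
have hE2 :=
  dice_sign_le n0 (x0 116%N) (x0 77%N) (x0 800%N) far K0 (x0 25%N) near.
have p0 : 0 < v ^+ 120 / 24 by rewrite divr_gt0.
have m0 : (0 < m)%N by [].
apply: le_trans (prob_beats_le K0 m0 W0 p0 card_dice_large SK hE1 hE2) _.
rewrite -/M.
set E := 2 * v ^+ 116 + 2 / M%:R.
have iM0 : 0 <= 2 / M%:R :> R by rewrite divr_ge0 ?ler0n.
have iK0 : 0 <= 2 / K%:R :> R by rewrite divr_ge0 ?ler0n.
have E0 : 0 <= E by rewrite /E; have := x0 116%N; lra.
have E1_le : (4 * v ^+ 77 + 2 / K%:R) * E + v ^+ 800 <= 16 * v ^+ 193.
  have h1 : 2 / K%:R <= v ^+ 77.
    have -> : 2 / K%:R = v ^+ 160 / 2.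
      by rewrite KE invfM -exprVn invN -exprM; field.
    have := vX (isT : (77 <= 160)%N); have := x0 160%N; lra.
  have h2 : (4 * v ^+ 77 + 2 / K%:R) * E <= (5 * v ^+ 77) * (3 * v ^+ 116).
    have := x0 77%N => h; apply: ler_pM => //; lra.
  have h3 : (5 * v ^+ 77) * (3 * v ^+ 116) = 15 * v ^+ 193 by ring.
  have := vX (isT : (193 <= 800)%N); lra.
set H := \sum_(d < K) _.
have H0 : 0 <= H by rewrite sumr_ge0.
have E2_le : 42 * H * (E * v ^+ 25 + v ^+ 800) <= 672 * v ^+ 139.
  have h1 : E * v ^+ 25 + v ^+ 800 <= 4 * v ^+ 141.
    have : E * v ^+ 25 <= 3 * v ^+ 116 * v ^+ 25 by rewrite ler_wpM2r.
    have -> : 3 * v ^+ 116 * v ^+ 25 = 3 * v ^+ 141 by ring.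
    have := vX (isT : (141 <= 800)%N); lra.
  apply: (@le_trans _ _ (42 * (4 * v ^- 2) * (4 * v ^+ 141))).
    apply: ler_pM => //.
    - by rewrite mulr_ge0 ?ler0n.
    - by rewrite addr_ge0 // mulr_ge0.
    by rewrite ler_wpM2l ?ler0n // harmonic_large.
  rewrite le_eqVlt; apply/orP; left; apply/eqP; field.
  by rewrite gt_eqF.
apply: (@le_trans _ _ ((672 * v ^+ 139 / 2 + 5 * v^-1 * (16 * v ^+ 193))
    / (v ^+ 120 / 24) + 882 * v)).
  apply: lerD; last first.
    rewrite ler_wpM2l ?ler0n // -[leRHS]invrK.
    by rewrite lef_pV2 ?posrE ?invr_gt0 ?ltr0n.
  rewrite ler_pM2r ?invr_gt0 //; apply: lerD.
    by rewrite ler_pM2r ?invr_gt0.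
  apply: ler_pM => //; apply: addr_ge0 => //; apply: mulr_ge0 => //.
  have := x0 77%N; lra.
have -> : (672 * v ^+ 139 / 2 + 5 * v^-1 * (16 * v ^+ 193)) / (v ^+ 120 / 24)
   = 2 * 4032 * v ^+ 19 + 1920 * v ^+ 72.
  by field; rewrite gt_eqF.
have bound (a b : R) : a <= v -> b <= v ->
    2 * 4032 * a + 1920 * b + 882 * v <= 10 ^+ 5 * v.
  by have : (0 : R) < v by []; move=> *; lra.
by apply: bound; rewrite -[leRHS]expr1 vX.
Qed.

End Large.

(** * The error function and its convergence to zero *)

Section Limit.
Variable R : realType.

Lemma prob_beats_trivial (n : nat) (A : {ffun 'I_n -> 'I_n}) :
  `|prob_beats R A - 2^-1| <= 1.
Proof.
have h0 : 0 <= prob_beats R A by rewrite divr_ge0.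
have h1 : prob_beats R A <= 1.
  rewrite /prob_beats; have [->|D0] := posnP #|dice n|.
    by rewrite invr0 mulr0.
  rewrite ler_pdivrMr ?ltr0n // mul1r ler_nat subset_leq_card //.
  by apply/fintype.subsetP => b; rewrite !inE => /andP[].
rewrite ler_norml; apply/andP; split; lra.
Qed.

Definition root80 (n : nat) : R := n%:R `^ 80^-1.

Lemma root80X (n : nat) : root80 n ^+ 80 = n%:R.
Proof.
by rewrite -powR_mulrn ?powR_ge0 // -powRrM mulVf ?pnatr_eq0 // powRr1.
Qed.

Lemma root80_ge (x : R) (n : nat) : 0 <= x -> x ^+ 80 <= n%:R -> x <= root80 n.
Proof.
by move=> x0; rewrite -root80X ler_pXn2r ?nnegrE ?powR_ge0.
Qed.

(** With [v = 1 / root80 n], the threshold is the condition [10^10 * v <= 1] of the asymptotic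
    estimates; below it the trivial bound 1 is taken. *)
Definition dice_eps (n : nat) : R :=
  if 10 ^+ 10 <= root80 n then 10 ^+ 5 / root80 n else 1.

Lemma dice_eps_cvg : (dice_eps n @[n --> \oo] --> (0 : R))%classic.
Proof.
apply/cvgrPdist_le => e e0.
pose X : R := 10 ^+ 10 + 10 ^+ 5 / e.
have X0 : 0 <= 10 ^+ 5 / e by rewrite divr_ge0 ?exprn_ge0 // ltW.
have X1 : 0 < X by apply: ltr_pwDl => //; exact: exprn_gt0.
near=> n.
have Xn : X <= root80 n.
  apply: root80_ge; first exact: ltW.
  apply: (@le_trans _ _ (Num.trunc (X ^+ 80)).+1%:R).
    exact/ltW/truncnS_gt.
  by rewrite ler_nat; near: n; exact: nbhs_infty_ge.
have r0 : 0 < root80 n by exact: lt_le_trans Xn.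
rewrite /dice_eps ifT; last by apply: le_trans Xn; rewrite lerDl.
rewrite sub0r normrN ger0_norm ?divr_ge0 ?exprn_ge0 ?(ltW r0) //.
rewrite ler_pdivrMr // mulrC -ler_pdivrMr //.
by apply: le_trans Xn; rewrite lerDr exprn_ge0.
Unshelve. all: by end_near. Qed.

End Limit.
Local Open Scope classical_set_scope.

Theorem theorem7p2 (R : realType) :
  exists eps : nat -> R,
    (eps n @[n --> \oo] --> (0 : R)) /\
    forall (n : nat) (A : {ffun 'I_n -> 'I_n}),
      (0 < n)%N ->
      A \in dice n ->
      \big[Num.max/0]_(j < n) `|gdie R A j| <= 2 * Num.sqrt (n%:R * ln n%:R) ->
      (forall alpha beta : R,
         - 2^-1 <= alpha <= 2^-1 ->
         - 2^-1 <= beta <= 2^-1 ->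
         `|alpha| >= 10 ^+ 7 * ln n%:R / n%:R \/
         `|beta| >= 10 ^+ 9 * (ln n%:R / n%:R) `^ (3 / 2) ->
         (ComplexField.Normc.normc (fhat A alpha beta)) ^+ n <= n%:R ^- 10) ->
      `|prob_beats R A - 2^-1| <= eps n.
Proof.
exists (dice_eps R); split; first exact: dice_eps_cvg.
move=> n A n0 Ad gmax decay; rewrite /dice_eps.
case: ifP => [big|_]; last exact: prob_beats_trivial.
have r0 : 0 < root80 R n by apply: lt_le_trans big; rewrite exprn_gt0.
apply: (@prob_beats_large R n A (root80 R n)^-1) => //.
- by rewrite invr_gt0.
- by rewrite ler_pdivrMr // mul1r.
- by rewrite exprVn root80X divff // pnatr_eq0 -lt0n.
rewrite exprVn ler_pdivrMr ?exprn_gt0 // mul1r.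
(* With [r = root80 n], [ln n = 80 * ln r], and both [80] and [ln r] are at most [r]. *)
rewrite -{1}root80X lnXn // -mulr_natl expr2.
apply: ler_pM => //.
- apply: ln_ge0; apply: le_trans big; lra.
- by apply: le_trans big; lra.
exact/ltW/ln_sublinear.
Qed.
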